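(* There exist absolute constants $C_2, C_3, C_4 > 0$ such that the following holds for every positive integer $k$ and every directed graph $G$. Let $p \in \{2,3,4\}$ and suppose that $G$ does not contain a family of $k$ directed cycles such that every vertex of $G$ is contained in at most $p$ of the cycles. (a) If $p=4$, then $G$ has a feedback vertex set of size at most $C_4 k^4$. (b) If $p=3$, then $G$ has a feedback vertex set of size at most $C_3 k^5$. (c) If $p=2$, then $G$ has a feedback vertex set of size at most $C_2 k^6$.
   Context: A feedback vertex set of a directed graph $G$ is a set $S \subseteq V(G)$ such that $G - S$ contains no directed cycle. The family of cycles is a multiset: a vertex lying on several cycles of the family (counted with multiplicity) is counted for each of them. *)

(* Defs.v *)
(* A directed graph is a finite vertex type T with an
   arbitrary (not necessarily symmetric) edge relation e : rel T. *)
From mathcomp Require Import all_boot.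
Set Implicit Arguments. Unset Strict Implicit. Unset Printing Implicit Defensive.

Definition dcycle (T : finType) (e : rel T) (c : seq T) : Prop :=
  [/\ c != [::], uniq c & cycle e c].

(* G contains a family (multiset, given as a list) of k directed cycles such
   that every vertex lies in at most p of them (counted with multiplicity). *)
Definition has_cycle_packing (T : finType) (e : rel T) (k p : nat) : Prop :=
  exists F : seq (seq T),
    [/\ size F = k, (forall c, c \in F -> dcycle e c)
      & forall v : T, count (fun c => v \in c) F <= p].

Definition feedback_vertex_set (T : finType) (e : rel T) (S : {set T}) : Prop :=
  ~ exists c : seq T, dcycle e c /\ all (fun v => v \notin S) c.

(* Main.v *)
(** Fix [s] and call a set [W] a haven of order [s] if deleting at most [s]
vertices always leaves a strong component with more than half of [W]. If there
is no haven, the usual recursion along balanced separators finds [k] disjoint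
cycles or a feedback vertex set of size [(3 s + 3) k].

Given a haven, some path meets all its strong sets, and it splits into [6 k]
disjoint subpaths [R], each consisting of two halves that cannot be separated
from the haven by fewer than [r] vertices. Duality for circulations in two
copies of the graph gives [r] disjoint walks from the first half to the second
and [r] disjoint walks back, with matching end points; following them
alternately orders the walks into closed walks. If there are [k] closed walks,
they form a half-integral packing; otherwise the walks of each subpath form a
chain with fewer than [k] breaks.

If the backward walks of two subpaths meet in more than [30 k M] pairs, where
[M] is the length of the chains, then [k] pairs of disjoint intervals of the
two chains cross in opposite orders, and each such pair contains a cycle. If all
pairs of subpaths meet rarely, Turan's argument selects [k] disjoint backward
walks on different subpaths, each closed into a cycle by its subpath. Every
vertex is visited at most twice by one chain, which yields congestion 4 with
[M = O(k^2)]. For congestion 2, cut a chain [2 k] times as long into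
intervals: [k] of them contain a cycle each, or one of them is a simple path. *)
Require Import Defs.
From mathcomp Require Import all_boot all_order fingroup perm all_algebra zify.
Set Implicit Arguments. Unset Strict Implicit. Unset Printing Implicit Defensive.

(** * Feedback vertex sets and balanced separators *)

Lemma connect_homo (T T' : finType) (r : rel T) (r' : rel T') (h : T -> T') :
  (forall x y, r x y -> connect r' (h x) (h y)) ->
  forall x y, connect r x y -> connect r' (h x) (h y).
Proof.
move=> hr x y /connectP[p]; elim: p x => [|z p IHp] x /=; first by move=> _ ->.
by case/andP=> /hr xz zp ey; apply: connect_trans xz (IHp _ zp ey).
Qed.

Lemma connect_exit (T : finType) (r : rel T) (Q : pred T) x y :
  connect r x y -> Q x -> ~~ Q y ->
  exists u v, [/\ connect r x u, r u v, Q u, ~~ Q v & connect r v y].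
Proof.
case/connectP=> p; elim: p x => [|z p IHp] x /=.
  by move=> _ -> ->.
case/andP=> xz zp ey Qx Qy; case Qz: (Q z); last first.
  by exists x, z; split; rewrite ?Qz ?connect0 //; apply/connectP; exists p.
have [u [v [zu uv Qu Qv vy]]] := IHp z zp ey Qz Qy.
by exists u, v; split=> //; apply: connect_trans (connect1 xz) zu.
Qed.

Lemma connect_terminal (T : finType) (r : rel T) x s s' :
  (forall u v v', r u v -> r u v' -> v = v') ->
  (forall v, ~~ r s v) -> (forall v, ~~ r s' v) ->
  connect r x s -> connect r x s' -> s = s'.
Proof.
move=> det ts ts' /connectP[p]; elim: p x => [|z p IHp] x /=.
  move=> _ <- /connectP[[|z q] //=].
  by rewrite (negbTE (ts z)).
case/andP=> xz zp es /connectP[[|z' q] /=].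
  by move=> _ es'; rewrite -es' (negbTE (ts' z)) in xz.
case/andP=> xz' zq es'; rewrite (det _ _ _ xz' xz) in zq es'.
by apply: IHp zp es _; apply/connectP; exists q.
Qed.

Lemma leq_cardsU (T : finType) (A B : {set T}) : #|A :|: B| <= #|A| + #|B|.
Proof. by rewrite cardsU leq_subr. Qed.

Lemma leq_cardsU1 (T : finType) x (A : {set T}) : #|x |: A| <= #|A|.+1.
Proof. by rewrite cardsU1 -add1n leq_add2r leq_b1. Qed.

Section Digraph.
Variables (T : finType) (e : rel T).
Implicit Types (S D X Y Z W U : {set T}) (p : seq T).

(** The induced subgraph, with the vertices outside [S] isolated rather than removed;
    [connect (er S)] stays reflexive on all of [T]. *)
Definition er S : rel T := [rel x y | [&& e x y, x \in S & y \in S]].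

Definition cyclicb S := [exists x, exists y, er S x y && connect (er S) y x].

Definition strong D := [forall x in D, forall y in D, connect (er D) x y].

Definition scc S x := [set y | connect (er S) x y && connect (er S) y x].

Lemma er_sub S S' : S \subset S' -> subrel (er S) (er S').
Proof.
by move=> /subsetP sS x y /and3P[exy /sS xS /sS yS]; rewrite /er /= exy xS.
Qed.

Lemma connect_er_sub S S' x y : S \subset S' ->
  connect (er S) x y -> connect (er S') x y.
Proof.
by move=> sS; apply: (@connect_homo _ _ _ _ id) => u v /(er_sub sS) /connect1.
Qed.

Lemma connect_er_in S x y : connect (er S) x y -> x \in S -> y \in S.
Proof.
case/connectP=> p; elim: p x => [|z p IHp] x /=; first by move=> _ ->.
by case/andP=> /and3P[_ _ zS] zp ey _; apply: IHp zp ey zS.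
Qed.

Lemma cyclicb_sub S S' : S \subset S' -> cyclicb S -> cyclicb S'.
Proof.
move=> sS /existsP[x /existsP[y /andP[xy yx]]].
apply/existsP; exists x; apply/existsP; exists y.
by rewrite (er_sub sS xy) (connect_er_sub sS yx).
Qed.

Lemma cyclicb_connect S x y : x != y ->
  connect (er S) x y -> connect (er S) y x -> cyclicb S.
Proof.
move=> nxy /connectP[[|z p] /=]; first by move=> _ exy; rewrite exy eqxx in nxy.
case/andP=> xz zp ey yx; apply/existsP; exists x; apply/existsP; exists z.
by rewrite xz (connect_trans _ yx) //; apply/connectP; exists p.
Qed.

Lemma cyclicP S : reflect (exists c, dcycle e c /\ {subset c <= S}) (cyclicb S).
Proof.
apply: (iffP existsP) => [[x /existsP[y /andP[xy /connectP[p yp xe]]]]|].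
  case: (shortenP yp) xe => q yq uq _ xe; exists (y :: q); split.
    split=> //=; rewrite rcons_path -xe.
    case/and3P: xy => -> _ _; rewrite andbT.
    by apply: sub_path yq => u v /and3P[].
  have yS : y \in S by case/and3P: xy.
  move=> u; rewrite inE => /predU1P[->//|].
  elim: q y {xy yp uq xe} yq yS => //= z q IHq y /andP[/and3P[_ _ zS] zq] _.
  by rewrite inE => /predU1P[->//|]; apply: IHq zq zS.
case=> c [[]]; case: c => // x p _ up cp sp; exists (last x p).
apply/existsP; exists x; move: cp; rewrite /= rcons_path => /andP[xp ex].
rewrite /er /= ex !sp ?mem_last ?inE ?eqxx //=.
apply/connectP; exists p => //.
elim: p x sp xp {up ex} => //= y p IHp x sp /andP[exy yp].
rewrite /er /= exy !sp ?inE ?eqxx ?orbT //=; apply: IHp yp => u up.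
by apply: sp; rewrite inE up orbT.
Qed.

Lemma fvsP S : feedback_vertex_set e S <-> ~~ cyclicb (~: S).
Proof.
split=> [h|/negP h [c [dc cS]]].
  apply/negP=> /cyclicP[c [dc cS]]; apply: h; exists c; split=> //.
  by apply/allP=> v /cS; rewrite inE.
apply: h; apply/cyclicP; exists c; split=> // v vc; rewrite inE.
by move/allP: cS; apply.
Qed.

(** Packings are assembled from vertex sets: a cycle chosen inside each set can only lower the
    congestion. *)
Lemma packing_of_cyclic_sets (F : seq {set T}) (k p : nat) :
  size F = k -> all cyclicb F ->
  (forall v, count (fun S : {set T} => v \in S) F <= p) ->
  has_cycle_packing e k p.
Proof.
move=> sF cF pF.
suff [C [sC dC cC]]: exists C : seq (seq T), [/\ size C = size F,
    forall c, c \in C -> dcycle e c &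
    forall v, count (fun c : seq T => v \in c) C
              <= count (fun S : {set T} => v \in S) F].
  exists C; split=> //; first by rewrite sC.
  by move=> v; apply: leq_trans (cC v) (pF v).
elim: F cF {sF pF} => [_|S F IHF /= /andP[/cyclicP[c [dc cS]] /IHF[C [sC dC cC]]]].
  by exists [::].
exists (c :: C); split=> /=; first by rewrite sC.
  by move=> c'; rewrite inE => /predU1P[->//|]; apply: dC.
move=> v; apply: leq_add (cC v).
by case vc: (v \in c) => //; rewrite (cS _ vc).
Qed.

Lemma packing_of_family (I : eqType) (l : seq I) (F : I -> {set T}) (k p : nat) :
  k <= size l -> {in l, forall i, cyclicb (F i)} ->
  (forall v, count (fun i => v \in F i) l <= p) -> has_cycle_packing e k p.
Proof.
move=> kl cF pF.
apply: (@packing_of_cyclic_sets [seq F i | i <- take k l]).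
- by rewrite size_map size_takel.
- by apply/allP=> _ /mapP[i /mem_take il ->]; apply: cF.
move=> v; rewrite count_map; apply: leq_trans (pF v).
by rewrite -{2}(cat_take_drop k l) count_cat leq_addr.
Qed.

Lemma has_packing_le (k p p' : nat) : p <= p' ->
  has_cycle_packing e k p -> has_cycle_packing e k p'.
Proof.
move=> pp [F [sF dF cF]]; exists F; split=> // v.
exact: leq_trans (cF v) pp.
Qed.

Lemma strongP D x y : strong D -> x \in D -> y \in D -> connect (er D) x y.
Proof. by move=> /forall_inP h /h /forall_inP; apply. Qed.

Lemma scc_refl S x : x \in scc S x.
Proof. by rewrite inE connect0. Qed.

Lemma scc_sub S x : x \in S -> scc S x \subset S.
Proof.
by move=> xS; apply/subsetP=> y; rewrite inE => /andP[/connect_er_in->].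
Qed.

Lemma connect_scc S a x y : connect (er S) x y ->
  connect (er S) a x -> connect (er S) y a -> connect (er (scc S a)) x y.
Proof.
case/connectP=> p; elim: p x => [|z p IHp] x /=; first by move=> _ ->.
case/andP=> xz zp ey ax ya.
have az := connect_trans ax (connect1 xz).
have zy : connect (er S) z y by apply/connectP; exists p.
apply: connect_trans (IHp z zp ey az ya); apply: connect1.
case/and3P: (xz) => exz _ _; rewrite /er /= exz !inE ax az /=.
by rewrite (connect_trans zy ya) (connect_trans (connect1 xz) (connect_trans zy ya)).
Qed.

Lemma scc_strong S x : strong (scc S x).
Proof.
apply/forall_inP=> u; rewrite inE => /andP[xu ux].
apply/forall_inP=> v; rewrite inE => /andP[xv vx].
by apply: connect_scc xu vx; apply: connect_trans ux xv.
Qed.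

Lemma strong_sub_scc S D x u : strong D -> D \subset S -> u \in D ->
  u \in scc S x -> D \subset scc S x.
Proof.
move=> sD DS uD; rewrite inE => /andP[xu ux]; apply/subsetP=> v vD.
have uv := connect_er_sub DS (strongP sD uD vD).
have vu := connect_er_sub DS (strongP sD vD uD).
by rewrite inE (connect_trans xu uv) (connect_trans vu ux).
Qed.

Lemma strongU D D' x : strong D -> strong D' -> x \in D -> x \in D' ->
  strong (D :|: D').
Proof.
move=> sD sD' xD xD'.
have h u : u \in D :|: D' ->
    connect (er (D :|: D')) u x /\ connect (er (D :|: D')) x u.
  rewrite inE => /orP[uD|uD]; split.
  - exact: connect_er_sub (subsetUl _ _) (strongP sD uD xD).
  - exact: connect_er_sub (subsetUl _ _) (strongP sD xD uD).
  - exact: connect_er_sub (subsetUr _ _) (strongP sD' uD xD').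
  - exact: connect_er_sub (subsetUr _ _) (strongP sD' xD' uD).
apply/forall_inP=> u /h[ux _]; apply/forall_inP=> v /h[_ xv].
exact: connect_trans ux xv.
Qed.

Lemma cyclic_scc S : cyclicb S ->
  exists2 x, x \in S & cyclicb (scc S x).
Proof.
case/existsP=> x /existsP[y /andP[xy yx]].
case/and3P: (xy) => exy xS yS; exists x => //.
apply/existsP; exists x; apply/existsP; exists y.
rewrite /er /= exy scc_refl inE (connect1 xy) yx /=.
exact: connect_scc yx (connect1 xy) (connect0 _ _).
Qed.

Definition bramble W D := strong D && (#|W| < 2 * #|D :&: W|).

Definition haven s W := [forall Z : {set T}, (#|Z| <= s) ==>
  [exists D, bramble W D && [disjoint D & Z]]].

(** Two strict majorities of [W] intersect. *)
Lemma bramble_meet W D D' : bramble W D -> bramble W D' ->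
  exists2 x, x \in D & x \in D'.
Proof.
case/andP=> _ cD /andP[_ cD'].
have [|] := set_0Vmem (D :&: D'); last first.
  by case=> x; rewrite inE => /andP[xD xD']; exists x.
move=> D0; exfalso.
have : #|(D :&: W) :&: (D' :&: W)| = 0.
  by apply/eqP; rewrite cards_eq0 -setIIl D0 set0I.
have := cardsUI (D :&: W) (D' :&: W).
have : #|(D :&: W) :|: (D' :&: W)| <= #|W|.
  by apply: subset_leq_card; rewrite -setIUl subsetIr.
lia.
Qed.

(* A minimal cyclic strong component U of a graph Y - X with X small: if X
   has a balanced separator Z then Z and one vertex of U break all cycles of
   U, as a component left over could replace U, with boundary Z and the part
   of X on its side of Z. *)
Lemma no_haven_cut s Y : (forall W, ~~ haven s W) -> cyclicb Y ->
  exists U (B : {set T}), [/\ cyclicb U, U \subset Y, #|B| <= 3 * s + 3,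
    ~~ cyclicb (U :\: B) &
    forall D, strong D -> D \subset Y :\: B -> ~~ [disjoint D & U] -> D \subset U].
Proof.
move=> nh cY.
(* The bound [2 * s + 2] reproduces itself: a new boundary consists of one vertex [v], a set [Z] of
   at most [s] vertices and at most half of the old [X]. *)
pose good U := [&& cyclicb U, strong U & [exists X : {set T},
  [&& #|X| <= 2 * s + 2, U \subset Y :\: X & [forall D : {set T},
   [&& strong D, D \subset Y :\: X & ~~ [disjoint D & U]] ==> (D \subset U)]]]].
have [x xY cx] := cyclic_scc cY.
have good0 : good (scc Y x).
  rewrite /good cx scc_strong /=; apply/existsP; exists set0.
  rewrite cards0 setD0 scc_sub //=; apply/forallP=> D.
  apply/implyP=> /and3P[sD DY]; rewrite -setI_eq0 => /set0Pn[u].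
  by rewrite inE => /andP[uD uU]; apply: strong_sub_scc sD DY uD uU.
have [U /minsetP[gU minU] _] := minset_exists good0.
case/and3P: gU => cU sU /existsP[X /and3P[cX UX /forallP mX]].
have {}mX D : strong D -> D \subset Y :\: X -> ~~ [disjoint D & U] -> D \subset U.
  by move=> ? ? ?; apply: (implyP (mX D)); apply/and3P.
(* The absence of havens is applied to [X] itself: no strong set avoiding [Z] holds more than half
   of [X]. Removing [v] as well makes the replacement [D] strictly smaller than [U]. *)
have /forallPn[Z] := nh X; rewrite negb_imply => /andP[cZ /existsPn hZ].
have [v vU] : exists v, v \in U.
  by case/existsP: cU => v /existsP[u /andP[/and3P[_ vU _] _]]; exists v.
exists U, (X :|: (v |: Z)); split=> //.
- exact: subset_trans UX (subsetDl _ _).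
- by move: cX cZ (leq_cardsU1 v Z) (leq_cardsU X (v |: Z)); clear; lia.
- apply/negP=> /cyclic_scc[d]; rewrite !inE !negb_or => /andP[/and3P[dX dv dZ] dU] cd.
  pose A := Y :\: (X :|: (v |: Z)); pose D := scc A d.
  have dY : d \in Y by move/subsetP: UX => /(_ d dU); rewrite inE => /andP[].
  have dA : d \in A by rewrite !inE !negb_or dX dv dZ dY.
  have DA : D \subset A by apply: scc_sub.
  have UA : U :\: (X :|: (v |: Z)) \subset A.
    by apply: setSD; apply: subset_trans UX (subsetDl _ _).
  have DX : D \subset Y :\: X by apply: subset_trans DA (setDS _ (subsetUl _ _)).
  have DU : D \subset U.
    apply: mX => //; first exact: scc_strong.
    by apply/pred0Pn; exists d; rewrite /= dU scc_refl.
  have vD : v \notin D.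
    by apply/negP=> /(subsetP DA); rewrite !inE eqxx orbT.
  suff gD : good D by have DE := minU _ gD DU; rewrite DE vU in vD.
  rewrite /good scc_strong /=; apply/andP; split.
    apply: cyclicb_sub cd; apply: strong_sub_scc (scc_refl _ _) (scc_refl _ _).
      exact: scc_strong.
    apply: subset_trans UA; apply: scc_sub.
    by rewrite !inE !negb_or dX dv dZ dU.
  (* A strong set that avoids [Z] and meets [D] stays inside [D'], so only the part of [X] in [D']
     has to remain in the boundary. *)
  pose D' := scc (Y :\: Z) d.
  have dYZ : d \in Y :\: Z by rewrite inE dZ.
  have D'Z : [disjoint D' & Z].
    rewrite disjoint_sym disjoints_subset.
    apply/subsetP=> z zZ; rewrite inE; apply/negP=> /(subsetP (scc_sub dYZ)).
    by rewrite inE zZ.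
  have DD' : D \subset D'.
    apply: strong_sub_scc (scc_refl _ _) (scc_refl _ _); first exact: scc_strong.
    apply: subset_trans DA _; apply: setDS; apply: subset_trans (subsetUr _ _).
    exact: subsetUr.
  have cD' : 2 * #|D' :&: X| <= #|X|.
    by move: (hZ D'); rewrite /bramble scc_strong D'Z andbT /= -leqNgt.
  apply/existsP; exists ((v |: Z) :|: (D' :&: X)); apply/and3P; split.
  - move: cD' cX cZ (leq_cardsU1 v Z) (leq_cardsU (v |: Z) (D' :&: X)).
    by clear; lia.
  - apply/subsetP=> u uD; move: (subsetP DA u uD); rewrite !inE !negb_or.
    case/andP=> /and3P[uX uv uZ] uY.
    by rewrite (negbTE uX) (negbTE uv) (negbTE uZ) uY andbF.
  apply/forallP=> F; apply/implyP=> /and3P[sF FY /pred0Pn[u /andP[/= uF uD]]].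
  have FD' : F \subset D'.
    apply: strong_sub_scc sF _ uF (subsetP DD' _ uD).
    apply: subset_trans FY _; apply: setDS; apply: subset_trans (subsetUl _ _).
    exact: subsetUr.
  apply: strong_sub_scc sF _ uF uD; apply/subsetP=> w wF.
  move: (subsetP FY _ wF); rewrite in_setD in_setU in_setI (subsetP FD' _ wF).
  rewrite /A !inE /= !negb_or.
  by case/andP=> /andP[/andP[-> ->] ->] ->.
move=> D sD DY; apply: mX => //.
by apply: subset_trans DY (setDS _ (subsetUl _ _)).
Qed.

(** Induction on [k]: [U] supplies one cycle and the recursion runs on [Y :\: B :\: U]. If it
    returns a set [S], a strong component avoiding [B :|: S] either misses [U] and is acyclic
    because of [S], or lies in [U] and is acyclic because of [B]. *)
Lemma no_haven_erdos_posa s k Y : (forall W, ~~ haven s W) ->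
  (exists F : seq {set T}, [/\ size F = k, all cyclicb F,
     {in F, forall S : {set T}, S \subset Y} &
     forall v, count (fun S : {set T} => v \in S) F <= 1]) \/
  (exists2 S : {set T}, #|S| <= (3 * s + 3) * k & ~~ cyclicb (Y :\: S)).
Proof.
move=> nh; elim: k Y => [|k IHk] Y; first by left; exists [::].
have [cY|ncY] := boolP (cyclicb Y); last first.
  by right; exists set0; rewrite ?cards0 ?setD0.
have [U [B [cU UY cB nUB mU]]] := no_haven_cut nh cY.
have [[F [sF cF FY F1]]|[S cS nS]] := IHk (Y :\: B :\: U).
  left; exists (U :: F); split=> /=; rewrite ?sF ?cU //.
    move=> S; rewrite inE => /predU1P[->//|/FY SY].
    by apply: subset_trans SY _; rewrite setDDl subsetDl.
  move=> v; case vU: (v \in U); last exact: F1.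
  suff /eqP->: count (fun S : {set T} => v \in S) F == 0 by [].
  rewrite -leqn0 leqNgt -has_count; apply/hasPn=> S SF.
  by apply/negP=> /(subsetP (FY _ SF)); rewrite inE vU.
right; exists (B :|: S).
  by rewrite mulnS; apply: leq_trans (leq_cardsU _ _) (leq_add _ _).
apply/negP=> /cyclic_scc[x xYS cx].
have sx := scc_sub xYS.
have sB : scc (Y :\: (B :|: S)) x \subset Y :\: B.
  by apply: subset_trans sx _; apply: setDS; apply: subsetUl.
have [dU|nU] := boolP [disjoint scc (Y :\: (B :|: S)) x & U].
  case/negP: nS; apply: cyclicb_sub cx; apply/subsetP=> u ux.
  move: (subsetP sx _ ux) (disjointFr dU ux); rewrite !inE negb_or => + ->.
  by case/andP=> /andP[-> ->] ->.
case/negP: nUB; apply: cyclicb_sub cx; apply/subsetP=> u ux.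
rewrite inE (subsetP (mU _ (scc_strong _ _) sB nU)) // andbT.
by move: (subsetP sB _ ux); rewrite inE => /andP[].
Qed.

End Digraph.

(** * Brambles *)

Section Brambles.
Variables (T : finType) (e : rel T).
Implicit Types (S D X Y Z W U : {set T}) (p : seq T).

(* The path is kept so that some bramble element Y meets it exactly in its
   last vertex; it can then be extended inside Y up to any element it misses. *)
Lemma bramble_path_extend W Y x p : path e x p -> uniq (x :: p) ->
  bramble e W Y -> last x p \in Y ->
  (forall v, v \in x :: p -> v \in Y -> v = last x p) ->
  exists q, [/\ path e x q, uniq (x :: q) &
                forall D, bramble e W D -> has (mem D) (x :: q)].
Proof.
have [n] := ubnP #|[set D | bramble e W D && ~~ has (mem D) (x :: p)]|.
elim: n p Y => // n IHn p Y cn xp up bY lY oY.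
have [|[D]] := set_0Vmem [set D | bramble e W D && ~~ has (mem D) (x :: p)].
  move=> h0; exists p; split=> // D bD; apply: contraT => nD.
  by move/setP: h0 => /(_ D); rewrite !inE bD nD.
rewrite inE => /andP[bD nD].
have [z zY zD] := bramble_meet bY bD.
case/andP: (bY) => sY _.
have /connectP[q0 yq0 ez0] := strongP sY lY zY.
case: (shortenP yq0) ez0 => q yq uq _ ez {q0 yq0}.
have lD : last x p \notin D.
  by apply: contra nD => lD; apply/hasP; exists (last x p); rewrite ?mem_last.
have hq : has (mem D) q.
  apply/hasP; exists z => //; have := mem_last (last x p) q.
  by rewrite -ez inE => /predU1P[zE|//]; rewrite -zE zD in lD.
have qY u : u \in q -> u \in Y.
  move: yq; clear; elim: q (last x p) => //= a q IHq b.
  case/andP=> /and3P[_ _ aY] aq; rewrite inE => /predU1P[->//|].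
  exact: IHq aq.
case: (split_find hq) yq uq qY {ez} => d q1 q2 dD nq1 yq uq qY.
rewrite cat_path in yq; case/andP: yq => yq _.
have sub : subrel (er e Y) e by move=> a b /and3P[].
have inP u : u \in rcons q1 d -> u \notin x :: p.
  move=> uq1; apply/negP=> uxp; have uE := oY u uxp (qY u _).
  move: uq; rewrite -cat_cons cons_uniq mem_cat -uE; last by rewrite mem_cat uq1.
  by rewrite uq1.
apply: (IHn (p ++ rcons q1 d) D) => //.
- rewrite ltnS in cn; apply: leq_trans cn; apply: proper_card.
  apply/properP; split.
    apply/subsetP=> F; rewrite !inE -cat_cons has_cat negb_or.
    by case/and3P=> -> ->.
  exists D; first by rewrite inE bD.
  by rewrite inE -cat_cons has_cat has_rcons dD /= !orbT andbF.
- by rewrite cat_path xp (sub_path sub yq).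
- rewrite -cat_cons cat_uniq up /=; apply/andP; split.
    by apply/hasPn=> u /inP.
  by move: uq; rewrite cons_uniq cat_uniq => /and3P[_ ->].
- by rewrite last_cat last_rcons.
move=> v; rewrite last_cat last_rcons -cat_cons mem_cat mem_rcons inE.
case/or3P=> [vp|/eqP//|vq1] vD.
  by case/hasP: nD; exists v.
by case/hasP: nq1; exists v.
Qed.

Lemma bramble_path s W : haven e s W ->
  exists p, [/\ sorted e p, uniq p &
                forall D, bramble e W D -> has (mem D) p].
Proof.
move/forallP/(_ set0); rewrite cards0 leq0n /= => /existsP[Y /andP[bY _]].
have [x xY] : exists x, x \in Y.
  case/andP: bY => _ cY; apply/set0Pn; apply: contraTneq cY => ->.
  by rewrite set0I cards0 muln0 ltn0.
have [||v|q [xq uq hq]] // := @bramble_path_extend W Y x [::] _ _ bY xY.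
  by rewrite inE => /eqP.
by exists (x :: q).
Qed.

Definition thick W r p := [forall Z : {set T}, (#|Z| < r) ==>
  [exists D, [&& bramble e W D, [disjoint D & Z] & has (mem D) p]]].

Lemma thickP W r p : reflect (forall Z, #|Z| < r ->
  exists D, [/\ bramble e W D, [disjoint D & Z] & has (mem D) p]) (thick W r p).
Proof.
apply: (iffP forallP) => h Z.
  by move=> cZ; have /implyP/(_ cZ)/existsP[D /and3P[]] := h Z; exists D.
by apply/implyP=> /h[D [? ? ?]]; apply/existsP; exists D; apply/and3P.
Qed.

Lemma haven_thick s W p : haven e s W ->
  (forall D, bramble e W D -> has (mem D) p) -> thick W s.+1 p.
Proof.
move=> /forallP hW hp; apply/thickP=> Z; rewrite ltnS => cZ.
have /implyP/(_ cZ)/existsP[D /andP[bD dD]] := hW Z.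
by exists D; split=> //; apply: hp.
Qed.

Lemma thickW W r r' p : r' <= r -> thick W r p -> thick W r' p.
Proof.
by move=> rr /thickP h; apply/thickP=> Z cZ; apply: h (leq_trans cZ rr).
Qed.

Lemma thick_split W r r' p : thick W (r + r') p ->
  exists p1 p2, [/\ p = p1 ++ p2, thick W r p1 & thick W r' p2].
Proof.
move=> tp; have ex : exists i, thick W r (take i p).
  by exists (size p); rewrite take_size (thickW _ tp) ?leq_addr.
case: (ex_minnP ex) => i ti mi.
exists (take i p), (drop i p); rewrite cat_take_drop; split=> //.
case: i ti mi => [|j] ti mi.
  by rewrite drop0 (thickW _ tp) ?leq_addl.
have [sj|js] := leqP (size p) j.
  have := mi j; rewrite ltnn => h; have /h// : thick W r (take j p).
  by rewrite take_oversize // -(@take_oversize _ j.+1 p) // leqW.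
have x0 : T by case: p js {tp ex ti mi}.
have /forallPn[Z1] : ~~ thick W r (take j p).
  by apply/negP=> /mi; rewrite ltnn.
rewrite negb_imply => /andP[cZ1 /existsPn hZ1].
apply/thickP=> Z cZ.
have [D [bD]] : exists D, [/\ bramble e W D,
   [disjoint D & (nth x0 p j |: (Z :|: Z1))] & has (mem D) p].
  move/thickP: tp; apply; apply: leq_ltn_trans (leq_cardsU1 _ _) _.
  by have := leq_cardsU Z Z1; move: cZ1 cZ; clear; lia.
move=> dD hD; have dF v : v \in D -> v \notin nth x0 p j |: (Z :|: Z1).
  by move=> vD; rewrite (disjointFr dD vD).
exists D; split=> //.
  apply/pred0P=> v /=; apply/negP=> /andP[/dF]; rewrite !inE.
  by case/norP=> _ /norP[/negbTE->].
move: hD; rewrite -{1}(cat_take_drop j p) (drop_nth x0 js) has_cat /=.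
case/or3P=> // [hD|/dF]; last by rewrite !inE eqxx.
case/negP: (hZ1 D); apply/and3P; split=> //.
apply/pred0P=> v /=; apply/negP=> /andP[/dF]; rewrite !inE.
by case/norP=> _ /norP[_ /negbTE->].
Qed.

Lemma thick_splits W r n p : thick W (n * r) p ->
  exists ps q, [/\ p = flatten ps ++ q, size ps = n & all (thick W r) ps].
Proof.
elim: n p => [|n IHn] p; first by move=> _; exists [::], p.
rewrite mulSn => /thick_split[p1 [p2 [-> t1 /IHn[ps [q [-> sp tp]]]]]].
by exists (p1 :: ps), q; rewrite /= catA sp t1.
Qed.

End Brambles.

(** * Circulations *)

Section Potential.
Import Order.TTheory GRing.Theory Num.Theory.
Local Open Scope ring_scope.
Variables (T : finType) (g : rel T) (gain : T -> T -> int).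

Fixpoint path_gain (u : T) (p : seq T) : int :=
  if p is v :: p' then gain u v + path_gain v p' else 0.

Lemma path_gain_cat u p q :
  path_gain u (p ++ q) = path_gain u p + path_gain (last u p) q.
Proof. by elim: p u => [|v p IHp] u /=; rewrite ?add0r // IHp addrA. Qed.

Lemma sum_gain_next u p : uniq (u :: p) ->
  \sum_(v <- u :: p) gain v (next (u :: p) v) = path_gain u (rcons p u).
Proof.
have : forall u0, uniq (u :: p) -> \sum_(v <- u :: p)
    gain v (next_at v u0 u p) = path_gain u (rcons p u0); last by apply.
move=> u0.
elim: p u => [|w p IHp] u /=; first by rewrite big_seq1 eqxx addr0.
case/andP=> up uwp; rewrite big_cons eqxx -IHp //; congr (_ + _).
rewrite big_seq [RHS]big_seq; apply: eq_bigr => v vp.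
by case: eqP => // vu; rewrite vu (negbTE up) in vp.
Qed.

(** Let [h u] be the largest gain of a simple path from [u]. Putting [u] in front of an optimal path
    from [v] gives a simple path, or else a cycle through [u], whose gain is not positive, followed
    by a simple path from [u]. *)
Lemma potential_exists :
  (forall u p, path g u (rcons p u) -> uniq (u :: p) ->
     path_gain u (rcons p u) <= 0) ->
  exists h : T -> int, forall u v, g u v -> gain u v + h v <= h u.
Proof.
move=> neg.
pose ok u (p : #|T|.-bseq T) := path g u p && uniq (u :: p).
pose h u := path_gain u [arg max_(p > [bseq] | ok u p) path_gain u p]%O.
have hmax u p : path g u p -> uniq (u :: p) -> path_gain u p <= h u.
  move=> gp up; have sp : (size p <= #|T|)%N.
    apply: leq_trans (max_card (mem (u :: p))); move/card_uniqP: up => -> /=.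
    exact: leqW.
  rewrite /h; case: arg_maxP => //= q _ /(_ (Bseq sp)); apply.
  by rewrite /ok /= gp; exact: up.
have hex u : exists p, [/\ path g u p, uniq (u :: p) & h u = path_gain u p].
  rewrite /h; case: arg_maxP => //= q /andP[gq uq] _.
  by exists q.
exists h => u v guv; have [p [vp up ->]] := hex v.
have [upp|npp] := boolP (u \in v :: p); last first.
  apply: (hmax u (v :: p)); first by rewrite /= guv.
  by rewrite cons_uniq npp.
have [q1 [q2 pE]] : exists q1 q2, v :: p = q1 ++ u :: q2.
  by case/splitPr: upp => q1 q2; exists q1, q2.
have -> : gain u v + path_gain v p = path_gain u (v :: p) by [].
have gvp : path g u (v :: p) by rewrite /= guv.
move: up gvp; rewrite pE -cat_rcons path_gain_cat last_rcons cat_path last_rcons.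
rewrite cat_rcons => uq /andP[gq1 gq2].
have uq1 : uniq (u :: q1).
  by rewrite cons_uniq; move: uq; rewrite cat_uniq /= negb_or => /and3P[-> /andP[->]].
have uq2 : uniq (u :: q2) by move: uq; rewrite cat_uniq => /and3P[].
by have := neg _ _ gq1 uq1; have := hmax _ _ gq2 uq2; lia.
Qed.
End Potential.

Section Circulation.
Import Order.TTheory GRing.Theory Num.Theory.
Variables (V : finType) (a f : rel V).

(* Linear programming duality for vertex-disjoint cycles maximising the number
   of special arcs: a permutation moving vertices only along arcs is a family
   of disjoint cycles; for an optimal one the residual digraph has no gaining
   cycle, hence a potential, and the vertices where the potential and its
   matched counterpart differ meet every closed walk through a special arc. *)
Lemma circulation_duality r :
  (forall v, ~~ f v v) ->
  (exists s : {perm V}, (forall v, (s v == v) || a v (s v)) /\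
     r <= #|[set v | f v (s v)]|) \/
  (exists2 Z : {set V}, #|Z| < r & forall u v, a u v -> f u v ->
     u \notin Z -> v \notin Z -> ~~ connect (er a (~: Z)) v u).
Proof.
move=> firr.
pose valid (s : {perm V}) := [forall v, (s v == v) || a v (s v)].
have valid1 : valid 1%g by apply/forallP=> v; rewrite perm1 eqxx.
pose wt (s : {perm V}) := #|[set v | f v (s v)]|.
case: (@arg_maxnP _ 1%g valid wt valid1) => s /forallP vs maxs.
have [rs|sr] := leqP r (wt s); [left; exists s; split=> // v; exact: vs|right].
pose w u v : int := Posz (f u v).
(* A residual arc from [u] to [u'] lets [u] take over the image of [u']. Rerouting [s] along a cycle
   of [g] gives the permutation [t], whose weight differs from that of [s] by the gain of the
   cycle. *)
pose g u u' := (s u' == u) || a u (s u').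
pose gain u u' : int := (w u (s u') - w u' (s u'))%R.
have wtE (t : {perm V}) : (Posz (wt t) = \sum_u w u (t u))%R.
  rewrite /wt -sum1dep_card big_mkcond /= (big_morph Posz PoszD erefl).
  by apply: eq_bigr => u _; rewrite /w; case: (f _ _).
have [u p gup uup|h hP] := @potential_exists _ g gain.
  pose c := u :: p.
  have cK : cancel (next c) (prev c) by apply: prev_next.
  pose t : {perm V} := (perm (can_inj cK) * s)%g.
  have tE v : t v = s (next c v) by rewrite permM permE.
  have vt : valid t.
    apply/forallP=> v; rewrite tE.
    have [vc|vc] := boolP (v \in c); last by rewrite next_nth (negbTE vc).
    by apply: (next_cycle (e := g)) vc; rewrite /= gup.
  have : wt t <= wt s := maxs _ vt.
  rewrite -sum_gain_next // -/c -lez_nat !wtE.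
  have -> : (\sum_(v <- c) gain v (next c v) = \sum_v gain v (next c v))%R.
    rewrite big_uniq // big_mkcond; apply: eq_bigr => v _.
    have [//|vc] := boolP (v \in c).
    by rewrite next_nth (negbTE vc) /gain subrr.
  rewrite /gain sumrB (eq_bigr (fun v => w v (s (next c v)))) => [|v _];
    last by rewrite tE.
  have -> : (\sum_v w v (s v) = \sum_v w (next c v) (s (next c v)))%R.
    exact: reindex_inj (can_inj cK).
  by rewrite -subr_le0.
(* [q] is the potential carried along the arcs of [s]. The differences [h v - q v] are nonnegative
   integers with sum [wt s], so fewer than [r] of them are nonzero; where they vanish, [h] never
   increases along an arc and drops along a special one. *)
pose q v : int := (h (s^-1 v)%g - w (s^-1 v)%g v)%R.
have hq u v : (u == v) || a u v -> (w u v + q v <= h u)%R.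
  move=> uv; have := hP u (s^-1 v)%g; rewrite /g /gain permKV eq_sym uv => /(_ isT).
  by rewrite /q; lia.
have hqv v : (q v <= h v)%R.
  by have := hq v v; rewrite eqxx => /(_ isT); rewrite /w (negbTE (firr v)); lia.
exists [set v | q v != h v].
  apply: leq_ltn_trans sr; rewrite -lez_nat wtE.
  have -> : (\sum_u w u (s u) = \sum_v (h v - q v))%R.
    have qE : (\sum_v q v = \sum_v q (s v))%R by apply: reindex_inj; apply: perm_inj.
    rewrite sumrB qE -sumrB.
    by apply: eq_bigr => v _; rewrite /q permK; lia.
  rewrite -sum1dep_card big_mkcond /= (big_morph Posz PoszD erefl).
  by apply: ler_sum => v _; have := hqv v; case: eqP => //= ne; lia.
move=> u v auv fuv; rewrite !inE !negbK => /eqP qu /eqP qv; apply/negP=> vu.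
suff : (h u <= h v)%R.
  by have := hq u v; rewrite auv orbT /w fuv qv => /(_ isT) /=; lia.
case/connectP: vu => p; elim: p v {auv fuv qv} => [|x p IHp] v /=.
  by move=> _ ->.
case/andP=> /and3P[avx]; rewrite !inE !negbK => _ /eqP qx xp eu.
apply: le_trans (IHp _ xp eu) _.
by have := hq v x; rewrite avx orbT qx /w => /(_ isT); lia.
Qed.
End Circulation.

(** * Braids *)

Lemma connect_stable (T : finType) (r : rel T) (Q : pred T) :
  (forall x y, r x y -> Q x -> Q y) -> forall x y, connect r x y -> Q x -> Q y.
Proof.
move=> rQ x y /connectP[p]; elim: p x => [|z p IHp] x /=; first by move=> _ ->.
by case/andP=> /rQ xz zp ey /xz; apply: IHp.
Qed.

Lemma path_er (T : finType) (e : rel T) (S : {set T}) x p :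
  path e x p -> {subset x :: p <= S} -> path (er e S) x p.
Proof.
elim: p x => //= y p IHp x /andP[exy yp] sS.
rewrite /er /= exy !sS ?inE ?eqxx ?orbT //=; apply: IHp => // z zp.
by apply: sS; rewrite inE zp orbT.
Qed.

Lemma connect_sorted_cat (T : finType) (e : rel T) p1 p2 x y :
  sorted e (p1 ++ p2) -> x \in p1 -> y \in p2 ->
  connect (er e [set v in p1 ++ p2]) x y.
Proof.
move=> + xp1; case/splitPr: xp1 => q1 q2; rewrite -catA.
set R := [set v in _]; move=> sp yp2.
have [q3 [q4 pE]] : exists q3 q4, q2 ++ p2 = q3 ++ y :: q4.
  by case/splitPr: yp2 => a b; exists (q2 ++ a), b; rewrite -catA.
have eR : R = [set v in q1 ++ x :: rcons q3 y ++ q4].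
  by rewrite /R cat_cons pE -(cat_rcons y).
apply/connectP; exists (rcons q3 y); last by rewrite last_rcons.
apply: path_er => [|v].
  move: sp; rewrite cat_cons pE -(cat_rcons y) => /cat_sorted2[_] /=.
  by rewrite cat_path => /andP[].
by move=> vp; rewrite eR in_set mem_cat -cat_cons mem_cat vp orbT.
Qed.

Section Braid.
Variables (T : finType) (e : rel T).

(* A family of walks U x, for x in A, where U x leads from x to nu x and ends
   with the part P x, which can be closed into a cycle through R. *)
Record braid (R A : {set T}) (nu : T -> T) (U P : T -> {set T}) : Prop := Braid {
  braid_nu_inj : injective nu;
  braid_nu : forall x, x \in A -> nu x \in A;
  braid_head : forall x, x \in A -> x \in U x;
  braid_from : forall x v, x \in A -> v \in U x -> connect (er e (U x)) x v;
  braid_to : forall x v, x \in A -> v \in U x ->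
    connect (er e (nu x |: U x)) v (nu x);
  braid_nu_notin : forall x, x \in A -> nu x != x -> nu x \notin U x;
  braid_other : forall x, x \in A -> exists2 y, y \in U x & y != x;
  braid_sub : forall x, x \in A -> P x \subset U x;
  braid_disjoint : forall x y v, x \in A -> y \in A ->
    v \in P x -> v \in P y -> x = y;
  braid_congestion : forall v, #|[set x in A | v \in U x]| <= 2;
  braid_close : forall x, x \in A -> cyclicb e (P x :|: R) }.

Variables (X1 X2 : seq T).

(* Two copies of the graph: walks go from X1 to X2 in the copy [true] and from
   X2 to X1 in the copy [false]; the switches at X1 are the special arcs. *)
Definition harc : rel (T * bool) := fun z z' =>
  if z.2 == z'.2 then e z.1 z'.1
  else (z.1 == z'.1) && (z.1 \in if z.2 then X2 else X1).

Definition hspec : rel (T * bool) := fun z z' =>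
  [&& ~~ z.2, z'.2, z.1 == z'.1 & z.1 \in X1].

(** A hitting set [Z] of fewer than [r] vertices projects to a set missed by bramble elements
    meeting [X1] and [X2]. These intersect, so their union is strong in both copies; switching at
    [X1] and at [X2] closes a walk through a special arc that avoids [Z]. *)
Lemma thick_circulation W r : thick e W r X1 -> thick e W r X2 ->
  exists s : {perm T * bool}, (forall z, (s z == z) || harc z (s z)) /\
    r <= #|[set z | hspec z (s z)]|.
Proof.
move=> /thickP t1 /thickP t2.
have [v|//|[Z cZ hZ]] := @circulation_duality _ harc hspec r.
  by rewrite /hspec; case: (v.2).
pose Z' := [set z.1 | z in Z].
have cZ' : #|Z'| < r by apply: leq_ltn_trans cZ; apply: leq_imset_card.
have [D1 [/[dup] bD1 /andP[sD1 _] dD1 /hasP[x xX /= xD]]] := t1 _ cZ'.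
have [D2 [/[dup] bD2 /andP[sD2 _] dD2 /hasP[y yX /= yD]]] := t2 _ cZ'.
have [w wD1 wD2] := bramble_meet bD1 bD2.
have sD := strongU sD1 sD2 wD1 wD2.
have nZ u b : u \in D1 :|: D2 -> (u, b) \notin Z.
  move=> uD; apply/negP=> uZ.
  have uZ' : u \in Z' by apply/imsetP; exists (u, b).
  move: uD; rewrite inE => /orP[uD|uD].
    by rewrite (disjointFr dD1 uD) in uZ'.
  by rewrite (disjointFr dD2 uD) in uZ'.
have xU : x \in D1 :|: D2 by rewrite inE xD.
have yU : y \in D1 :|: D2 by rewrite inE yD orbT.
have lift u v b : u \in D1 :|: D2 -> v \in D1 :|: D2 ->
    connect (er harc (~: Z)) (u, b) (v, b).
  move=> uD vD; apply: (connect_homo (h := fun u => (u, b))) (strongP sD uD vD).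
  move=> u' v' /and3P[euv uD' vD']; apply: connect1.
  by rewrite /er /= /harc /= eqxx euv !inE !nZ.
have a1 : harc (x, false) (x, true) by rewrite /harc /= eqxx.
have a2 : hspec (x, false) (x, true) by rewrite /hspec /= eqxx.
case/negP: (hZ _ _ a1 a2 (nZ _ _ xU) (nZ _ _ xU)).
apply: connect_trans (lift x y true xU yU) _.
apply: connect_trans (lift y x false yU xU); apply: connect1.
by rewrite /er /= /harc /= eqxx yX !inE !nZ.
Qed.

(** Cutting the cycles of [s] at the special arcs leaves segments from [(x, true)] to
    [(nu x, false)]. [U x] projects such a segment without its end, [P x] only its part in the copy
    [false]. Having two copies, a vertex lies in at most two [U x] but in one [P x]. From [X2] the
    part [P x] leads to [nu x] in [X1], and the subpath leads back. *)
Lemma braid_of_circulation (s : {perm T * bool}) r :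
  sorted e (X1 ++ X2) -> uniq (X1 ++ X2) ->
  (forall z, (s z == z) || harc z (s z)) ->
  r <= #|[set z | hspec z (s z)]| ->
  exists (A : {set T}) nu U P, r <= #|A| /\ braid [set v in X1 ++ X2] A nu U P.
Proof.
move=> sX uX vs rs.
have dX x : x \in X1 -> x \notin X2.
  move: uX; rewrite cat_uniq => /and3P[_ /hasPn h _] xX1.
  by apply/negP=> /h /negP[].
pose A := [set x | hspec (x, false) (s (x, false))].
have AP x : x \in A -> s (x, false) = (x, true) /\ x \in X1.
  rewrite inE; case E: (s _) => [u b] /and4P[_ /= -> /eqP /= <- xX].
  by [].
have rA : r <= #|A|.
  have <- : #|[set (x, false) | x in A]| = #|A| by apply: card_imset => x y [].
  apply: leq_trans rs _; apply: subset_leq_card; apply/subsetP=> -[x [|]].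
    by rewrite inE.
  by rewrite inE => h; apply/imsetP; exists x => //; rewrite inE.
(* Marked vertices are the tails of the special arcs used by [s]; [step] follows [s] but stops
   there. *)
pose mark (z : T * bool) := ~~ z.2 && (z.1 \in A).
pose step (z z' : T * bool) := (s z == z') && ~~ mark z.
have detf z u v : step z u -> step z v -> u = v.
  by case/andP=> /eqP<- _ /andP[/eqP<-].
have detb z u v : step u z -> step v z -> u = v.
  by case/andP=> /eqP<- _ /andP[/eqP/perm_inj-> _].
have startN x z : x \in A -> ~~ step z (x, true).
  move=> xA; apply/negP=> /andP[/eqP sz]; have [sx _] := AP x xA.
  by rewrite -sx in sz; move/perm_inj: sz => ->; rewrite /mark /= xA.
have endN x z : x \in A -> ~~ step (x, false) z.
  by move=> xA; rewrite /step /= /mark /= xA andbF.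
pose seg x z := connect step (x, true) z.
have seg_inj x y z : x \in A -> y \in A -> seg x z -> seg y z -> x = y.
  have rev u v : connect step u v -> connect [rel a b | step b a] v u.
    by rewrite connect_rev.
  move=> xA yA /rev xz /rev yz.
  suff [] : (x, true) = (y, true) by [].
  apply: connect_terminal xz yz => [u v v'|v|v]; [exact: detb| |]; exact: startN.
(* Following [s] from [z] eventually returns to [(x, false)], the predecessor of [(x, true)], so
   some marked vertex stops the segment. *)
have ex_end x z : x \in A -> seg x z ->
    exists2 x', x' \in A & connect step z (x', false).
  move=> xA xz.
  have [/existsP[x' /andP[]]|/existsPn h] :=
    boolP [exists x', (x' \in A) && connect step z (x', false)].
    by exists x'.
  have [sx _] := AP x xA.
  have h' u : connect step z u -> ~~ mark u.
    case: u => u [|] //= zu; apply/negP; rewrite /mark /= => uA.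
    by have /negP[] := h u; rewrite uA.
  have : fconnect s z (x, false).
    rewrite fconnect_sym; last exact: perm_inj.
    apply: connect_trans (_ : fconnect s (x, true) z).
      by apply: connect1; rewrite /= sx.
    apply: (connect_homo (h := id)) xz => u v /andP[uv _]; exact: connect1.
  move=> zx; exists x => //.
  apply: (@connect_stable _ _ (connect step z)) zx (connect0 _ _) => u v /eqP<- zu.
  by apply: (connect_trans zu (connect1 _)); rewrite /step eqxx h'.
pose nu x := if x \in A then
  odflt x [pick x' | (x' \in A) && connect step (x, true) (x', false)] else x.
have nuP x : x \in A -> nu x \in A /\ seg x (nu x, false).
  move=> xA; rewrite /nu xA; case: pickP => [x' /andP[]//|h].
  have [x' x'A c] := ex_end x _ xA (connect0 _ _).
  by have := h x'; rewrite x'A c.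
have seg_end x z : x \in A -> seg x z -> connect step z (nu x, false).
  move=> xA xz; have [x' x'A zx'] := ex_end x z xA xz.
  have [nA xn] := nuP x xA; have xx' := connect_trans xz zx'.
  suff -> : (nu x, false) = (x', false) by [].
  apply: connect_terminal xn xx' => [|v|v]; [exact: detf| |]; exact: endN.
(* The copy changes only once in a segment: [s] goes from [false] back to [true] only by special
   arcs, whose tails are marked. *)
have dir z : ~~ z.2 -> ~~ mark z -> ~~ (s z).2.
  case: z => z b /= nb; rewrite (negbTE nb) /mark /= => zA.
  apply/negP=> sz; case/negP: zA; rewrite inE.
  have := vs (z, false); rewrite /harc /hspec sz /=.
  by case/predU1P=> [zE|//]; rewrite zE in sz.
have lift (S : {set T}) (z z' : T * bool) :
    (forall u, connect step z u -> ~~ mark u -> u.1 \in S) ->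
    z'.1 \in S -> connect step z z' -> connect (er e S) z.1 z'.1.
  move=> hS z'S /connectP[p zp ez']; elim: p z hS zp ez' => [|y p IHp] z hS /=.
    by move=> _ ->.
  case/andP=> /andP[/eqP zy nz] yp ez'.
  have szy : step z y by rewrite /step zy eqxx nz.
  have yS : y.1 \in S.
    case: p yp ez' {IHp} => [|x p] /=; first by move=> _ <-.
    by case/andP=> /andP[_ ny] _ _; apply: hS ny; apply: connect1.
  apply: connect_trans (IHp y _ yp ez') => [|u yu nu']; last first.
    by apply: hS => //; apply: connect_trans (connect1 szy) yu.
  have := vs z; rewrite zy => /predU1P[-> //|].
  rewrite /harc; case: eqP => _ => [ezy|/andP[/eqP-> _]//].
  by apply: connect1; rewrite /er /= ezy yS hS.
pose U x := [set v | [exists b, seg x (v, b) && ~~ mark (v, b)]].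
pose P x := [set v | seg x (v, false) && ~~ mark (v, false)].
have segU x z : seg x z -> ~~ mark z -> z.1 \in U x.
  by case: z => v b xz nz; rewrite inE; apply/existsP; exists b; rewrite xz.
have PU x : P x \subset U x.
  by apply/subsetP=> v; rewrite inE => /andP[xv nv]; apply: segU xv nv.
have cross x : x \in A -> exists y, [/\ y \in X2, y != x & y \in P x].
  move=> xA; have [nA xn] := nuP x xA; have [sx xX1] := AP x xA.
  have [u [v [xu uv /= u2 v2 vn]]] := connect_exit (Q := fun z => z.2) xn isT isT.
  have xv := connect_trans xu (connect1 uv).
  case/andP: uv => /eqP suv _; have := vs u; rewrite suv.
  case/predU1P=> [vu|]; first by rewrite vu u2 in v2.
  case: u v u2 v2 xv {xu vn suv} => [u [|]] [v [|]] //= _ _ xv.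
  rewrite /harc /= => /andP[/eqP uE uX2]; subst v.
  exists u; split=> //.
    by apply: contraTneq uX2 => ->; apply: dX.
  rewrite inE /seg xv /mark /=; apply/negP=> /AP[_ /dX]; by rewrite uX2.
exists A, nu, U, P; split=> //; split.
- move=> x y; have [xA|xA] := boolP (x \in A); have [yA|yA] := boolP (y \in A).
  + have [_ xn] := nuP x xA; have [_ yn] := nuP y yA => nE.
    by rewrite nE in xn; apply: seg_inj xn yn.
  + have [nA _] := nuP x xA; rewrite [nu y]/nu (negbTE yA) => nE.
    by rewrite nE (negbTE yA) in nA.
  + have [nA _] := nuP y yA; rewrite [nu x]/nu (negbTE xA) => nE.
    by rewrite -nE (negbTE xA) in nA.
  by rewrite /nu (negbTE xA) (negbTE yA).
- by move=> x /nuP[].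
- by move=> x xA; apply: (segU x (x, true)) => //; apply: connect0.
- move=> x v xA vU; move: (vU); rewrite inE => /existsP[b /andP[xv nv]].
  apply: (lift (U x) (x, true) (v, b)) => // u xu nu'; exact: segU.
- move=> x v xA; rewrite inE => /existsP[b /andP[xv nv]].
  apply: (lift (nu x |: U x) (v, b) (nu x, false)); last exact: seg_end.
    move=> u vu nu'; rewrite inE segU ?orbT //; exact: connect_trans xv vu.
  by rewrite !inE eqxx.
- move=> x xA nx; apply/negP; rewrite inE => /existsP[[|] /andP[xv nv]]; last first.
    by case/negP: nv; rewrite /mark /=; case: (nuP x xA).
  case/eqP: nx; have [nA _] := nuP x xA.
  by apply/esym; apply: seg_inj xv (connect0 _ _).
- by move=> x /cross[y [_ yx yP]]; exists y => //; apply: (subsetP (PU x)).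
- by move=> x _; apply: PU.
- move=> x y v xA yA; rewrite !inE => /andP[xv _] /andP[yv _].
  exact: seg_inj xv yv.
- move=> v; pose Q b := [set x in A | seg x (v, b)].
  have Q1 b : #|Q b| <= 1.
    apply/card_le1_eqP=> x y.
    rewrite in_set => /andP[xA xv]; rewrite in_set => /andP[yA yv].
    by rewrite (seg_inj x y (v, b)).
  apply: (@leq_trans #|Q true :|: Q false|); last first.
    by apply: leq_trans (leq_cardsU _ _) _; apply: (leq_add (Q1 _) (Q1 _)).
  apply: subset_leq_card; apply/subsetP=> x; rewrite in_set => /andP[xA].
  rewrite in_set => /existsP[b /andP[xv _]].
  have: x \in Q b by rewrite in_set xA xv.
  by rewrite in_setU; case: (b) => ->; rewrite ?orbT.
move=> x xA; have [y [yX2 yx yP]] := cross x xA.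
have [nA _] := nuP x xA; have [_ nX1] := AP _ nA.
apply: (@cyclicb_connect _ _ _ y (nu x)).
- by apply: contraTneq yX2 => ->; apply: dX.
- move: (yP); rewrite inE => /andP[xy ny].
  apply: (lift _ (y, false) (nu x, false)); last exact: seg_end.
    move=> u yu nu'; have u2 : ~~ u.2.
      apply: (@connect_stable _ _ (fun z => ~~ z.2)) yu isT => a b.
      by case/andP=> /eqP<- na a2; apply: dir.
    case: u yu nu' u2 => u [|] // yu nu' _.
    rewrite in_setU; apply/orP; left; rewrite in_set; apply/andP; split=> //.
    exact: connect_trans xy yu.
  by rewrite in_setU !inE mem_cat nX1 orbT.
apply: connect_er_sub (subsetUr _ _) _; exact: connect_sorted_cat.
Qed.

Lemma thick_braid W r : sorted e (X1 ++ X2) -> uniq (X1 ++ X2) ->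
  thick e W r X1 -> thick e W r X2 ->
  exists (A : {set T}) nu U P, r <= #|A| /\ braid [set v in X1 ++ X2] A nu U P.
Proof.
move=> sX uX t1 t2; have [s [vs rs]] := thick_circulation t1 t2.
exact: braid_of_circulation vs rs.
Qed.

End Braid.

(** * Chains *)

Lemma orbit_listing (T : finType) (nu : T -> T) (A : {set T}) :
  injective nu -> (forall x, x \in A -> nu x \in A) ->
  exists xs : seq T, [/\ {subset xs <= A},
    uniq (flatten [seq orbit nu x | x <- xs]) &
    flatten [seq orbit nu x | x <- xs] =i A].
Proof.
move=> inj; have [n] := ubnP #|A|; elim: n A => // n IHn A cA nuA.
have [->|[x xA]] := set_0Vmem A.
  by exists [::]; split=> // x; rewrite !inE.
have oA y : y \in orbit nu x -> y \in A.
  rewrite -fconnect_orbit => xy; apply: (connect_stable _ xy xA) => u v.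
  by move=> /eqP<-; apply: nuA.
pose B := [set y in A | y \notin orbit nu x].
have [||xs [sxs uxs fxs]] := IHn B.
- rewrite ltnS in cA; apply: leq_trans cA; apply: proper_card.
  apply/properP; split; first by apply/subsetP=> y; rewrite inE => /andP[].
  by exists x => //; rewrite inE in_orbit andbF.
- move=> y; rewrite !inE -!fconnect_orbit => /andP[yA xy]; rewrite nuA //=.
  apply: contra xy => xy; apply: connect_trans xy _.
  by rewrite fconnect_sym // fconnect1.
exists (x :: xs); split=> /=.
- move=> y; rewrite inE => /predU1P[->//|/sxs]; by rewrite inE => /andP[].
- rewrite cat_uniq orbit_uniq uxs andbT /=; apply/hasPn=> y.
  by rewrite fxs inE => /andP[].
move=> y; rewrite mem_cat fxs inE.
by case oy: (y \in orbit nu x); rewrite ?andbT // oA.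
Qed.

Lemma orbit_blocks (T : finType) (nu : T -> T) (x0 : T) (xs : seq T) :
  let s := flatten [seq orbit nu x | x <- xs] in
  exists b : nat -> nat, [/\ forall i j, i <= j -> b i <= b j,
    forall i, i < size s -> b i < size xs &
    forall i, i.+1 < size s -> b i = b i.+1 -> nth x0 s i.+1 = nu (nth x0 s i)].
Proof.
elim: xs => [|x xs [b [mb bx nb]]] /=; first by exists id.
set o := orbit nu x; set s := flatten _ in mb bx nb *.
exists (fun i => if i < size o then 0 else (b (i - size o)).+1); split.
- move=> i j ij; case: (ltnP i (size o)) => // oi.
  rewrite [j < _]ltnNge (leq_trans oi ij) /= ltnS.
  by apply: mb; rewrite leq_sub2r.
- move=> i; rewrite size_cat => io; case: (ltnP i (size o)) => // oi; rewrite ltnS.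
  by apply: bx; rewrite ltn_subLR.
move=> i; rewrite size_cat !nth_cat => is_.
case: (ltnP i.+1 (size o)) => [io|oi].
  rewrite (ltnW io) => _; rewrite !(set_nth_default x x0) ?(ltnW io) //.
  rewrite /o /orbit size_traject in io.
  by rewrite /o /orbit !nth_traject ?(ltnW io).
case: (ltnP i (size o)) => // oi'; rewrite subSn // => -[bE].
by apply: nb => //; rewrite -subSn // ltn_subLR.
Qed.

Section Chain.
Variables (T : finType) (e : rel T).

(* M consecutive walks U 0, U 1, ..., linked end to end except where the block
   index b increases; each vertex lies in at most q of them. *)
Record chain (R : {set T}) (k q M : nat) (U P : nat -> {set T})
    (hd : nat -> T) (b : nat -> nat) : Prop := Chain {
  chain_mono : forall i j, i <= j -> j < M -> b i <= b j;
  chain_lt : forall i, i < M -> b i < k;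
  chain_head : forall i, i < M -> hd i \in U i;
  chain_from : forall i v, i < M -> v \in U i -> connect (er e (U i)) (hd i) v;
  chain_to : forall i v, i.+1 < M -> b i = b i.+1 -> v \in U i ->
    connect (er e (hd i.+1 |: U i)) v (hd i.+1);
  chain_next_notin : forall i, i.+1 < M -> b i = b i.+1 -> hd i.+1 \notin U i;
  chain_sub : forall i, i < M -> P i \subset U i;
  chain_disjoint : forall i j v, i < M -> j < M -> v \in P i -> v \in P j -> i = j;
  chain_congestion : forall v, #|[set i : 'I_M | v \in U i]| <= q;
  chain_close : forall i, i < M -> cyclicb e (P i :|: R) }.

(** Each orbit of [nu] is a closed walk. If there are [k] orbits they form the packing; otherwise
    the orbits listed one after another form a chain, with [b] numbering the orbits. *)
Lemma braid_chain R A nu U P k M : braid e R A nu U P -> 0 < M <= #|A| ->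
  has_cycle_packing e k 2 \/ exists U' P' hd b, chain R k 2 M U' P' hd b.
Proof.
case=> inj nuA hU fU tU nnU oU sP dP cU clP /andP[M0 MA].
have [xs [sxs us fs]] := orbit_listing inj nuA.
set s := flatten _ in us fs.
have ss : size s = #|A| by rewrite -(card_uniqP us); apply: eq_card.
have [x0 _] : exists x, x \in A by apply/card_gt0P; apply: leq_trans MA.
have [kx|xk] := leqP k (size xs); [left|right].
  pose F x := [set v | has (fun y => v \in U y) (orbit nu x)].
  have FU x y : y \in orbit nu x -> U y \subset F x.
    by move=> xy; apply/subsetP=> v vU; rewrite inE; apply/hasP; exists y.
  apply: (@packing_of_family _ _ _ xs F _ _ kx) => [x /sxs xA|v].
    have oA y : y \in orbit nu x -> y \in A.
      rewrite -fconnect_orbit => xy; apply: (connect_stable _ xy xA) => u v.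
      by move=> /eqP<-; apply: nuA.
    have onu y : y \in orbit nu x -> nu y \in orbit nu x.
      by rewrite -!fconnect_orbit => xy; apply: connect_trans xy (fconnect1 _ _).
    have toF y v : y \in orbit nu x -> v \in U y -> connect (er e (F x)) v (nu y).
      move=> oy vU; apply: connect_er_sub (tU _ _ (oA _ oy) vU).
      rewrite subUset FU // andbT sub1set.
      by apply: (subsetP (FU _ _ (onu _ oy))); apply/hU/oA/onu.
    have [y yU yx] := oU x xA.
    apply: (@cyclicb_connect _ _ _ y x) => //; last first.
      by apply: connect_er_sub (fU _ _ xA yU); apply: FU; apply: in_orbit.
    apply: connect_trans (toF x y (in_orbit _ _) yU) _.
    have nx : fconnect nu (nu x) x by rewrite fconnect_sym // fconnect1.
    pose Q z := (z \in orbit nu x) && connect (er e (F x)) (nu x) z.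
    suff /andP[] : Q x by [].
    apply: connect_stable nx _ => [u v /eqP<- /andP[ou nu_u]|].
      rewrite /Q onu //=; apply: connect_trans nu_u _.
      by apply: toF => //; apply/hU/oA.
    by rewrite /Q onu ?in_orbit //=.
  apply: leq_trans (cU v).
  have -> : #|[set x in A | v \in U x]| = count (fun x => v \in U x) s.
    rewrite -size_filter -(card_uniqP (filter_uniq _ us)).
    by apply: eq_card => x; rewrite !inE mem_filter fs andbC.
  rewrite /s; elim: (xs) => //= x l IHl; rewrite count_cat.
  apply: leq_add IHl; rewrite inE has_count.
  by case: (count _ _).
have [b [mb bx nb]] := orbit_blocks nu x0 xs; rewrite -/s in bx nb.
pose hd i := nth x0 s i.
have Ms i : i < M -> i < size s by move=> iM; rewrite ss (leq_trans iM).
have hdA i : i < M -> hd i \in A by move=> /Ms is_; rewrite -fs mem_nth.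
have hd_inj i j : i < M -> j < M -> hd i = hd j -> i = j.
  by move=> /Ms is_ /Ms js /eqP; rewrite nth_uniq // => /eqP.
exists (U \o hd), (P \o hd), hd, b; split.
- by move=> i j ij _; apply: mb.
- by move=> i /Ms /bx bi; apply: ltn_trans bi xk.
- by move=> i /hdA /hU.
- by move=> i v /hdA /fU; apply.
- move=> i v iM bE vU; rewrite [hd i.+1]nb //; last exact: Ms.
  by apply: tU => //; apply/hdA/ltnW.
- move=> i iM bE; rewrite [hd i.+1]nb //; last exact: Ms.
  apply: nnU; first by apply/hdA/ltnW.
  apply/eqP; rewrite -nb //; last exact: Ms.
  by move/(hd_inj _ _ iM (ltnW iM)) => /eqP; rewrite eqn_leq ltnn.
- by move=> i /hdA /sP.
- by move=> i j v iM jM vi vj; apply: hd_inj => //; apply: dP vi vj; apply: hdA.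
- move=> v; apply: leq_trans (cU v).
  rewrite -(card_in_imset (f := fun i : 'I_M => hd i)) => [|i j _ _ /hd_inj h].
    apply: subset_leq_card; apply/subsetP=> _ /imsetP[i + ->].
    by rewrite !inE => vU; rewrite hdA.
  exact/val_inj/h.
- by move=> i /hdA /clP.
Qed.

(** The indices must differ: within a single walk [w] may precede [v], but from a later walk
    everything is reached through its head. *)
Lemma chain_connect R k q M U P hd b (S : {set T}) i j v w :
  chain R k q M U P hd b -> i < j -> j < M -> b i = b j ->
  (forall t, i <= t <= j -> U t \subset S) ->
  v \in U i -> w \in U j -> connect (er e S) v w.
Proof.
move=> C ij jM bE US vi wj.
apply: (@connect_trans _ _ (hd j)); last first.
  by apply: connect_er_sub (chain_from C jM wj); apply: US; rewrite leqnn ltnW.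
have one t u : i <= t -> t < j -> u \in U t -> connect (er e S) u (hd t.+1).
  move=> it tj ut; have tM := leq_trans tj (ltnW jM).
  have t1M := leq_ltn_trans tj jM.
  have bt : b t = b t.+1.
    have := chain_mono C it tM; have := chain_mono C (leqnSn t) t1M.
    have := chain_mono C tj jM; move: bE; clear; lia.
  apply: connect_er_sub (chain_to C t1M bt ut).
  rewrite subUset sub1set (subsetP (US t.+1 _)) ?(chain_head C) ?(leqW it) //=.
  by apply: US; rewrite it ltnW.
have : forall d, i + d < j -> connect (er e S) v (hd (i + d).+1).
  elim=> [|d IHd]; first by rewrite addn0 => _; apply: one.
  rewrite addnS => dj; apply: connect_trans (IHd (ltnW dj)) _.
  apply: one => //; first by rewrite leqW ?leq_addr.
  by apply: (chain_head C); apply: ltn_trans dj jM.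
by move/(_ (j.-1 - i)); rewrite subnKC ?prednK; [apply| |]; move: ij; clear; lia.
Qed.

Lemma chain_overlap R k q M U P hd b (S : {set T}) i j v :
  chain R k q M U P hd b -> i < j -> j < M -> b i = b j ->
  (forall t, i <= t <= j -> U t \subset S) ->
  v \in U i -> v \in U j -> cyclicb e S.
Proof.
move=> C ij jM bE US vi vj.
have iM := leq_ltn_trans ij jM.
have bt : b i = b i.+1.
  have := chain_mono C (leqnSn i) iM; have := chain_mono C ij jM.
  by move: bE; clear; lia.
have hS : hd i.+1 \in S.
  by apply: (subsetP (US i.+1 _)); rewrite ?leqnSn // (chain_head C).
apply: (@cyclicb_connect _ _ _ v (hd i.+1)).
- by apply: contraNneq (chain_next_notin C iM bt) => <-.
- apply: connect_er_sub (chain_to C iM bt vi).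
  by rewrite subUset sub1set hS US // leqnn ltnW.
move: ij; rewrite leq_eqVlt => /predU1P[ij|ij].
  by rewrite ij; apply: connect_er_sub (chain_from C jM vj); apply: US; lia.
apply: (chain_connect C ij jM _ _ (chain_head C iM) vj); first by rewrite -bt.
by move=> t /andP[it tj]; apply: US; rewrite tj ltnW.
Qed.

(** Cut the chain into [2 * k] intervals of length [M]. At least [k] of them lie in a single block.
    If the walks of one such interval are pairwise disjoint, it is a chain of congestion 1;
    otherwise each contains a cycle by overlap, and distinct intervals use distinct walks. *)
Lemma chain_refine R k q M U P hd b : 0 < M -> chain R k q (2 * k * M) U P hd b ->
  has_cycle_packing e k q \/ exists U' P' hd' b', chain R k 1 M U' P' hd' b'.
Proof.
move=> M0 C.
have idx (c : 'I_(2 * k)) i : i < M -> c * M + i < 2 * k * M.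
  move=> iM; apply: (@leq_trans (c.+1 * M)); first by rewrite (mulSn c) addnC ltn_add2r.
  by rewrite leq_mul2r ltn_ord orbT.
pose flat := [set c : 'I_(2 * k) | b (c * M) == b (c * M + M.-1)].
have bflat c i : c \in flat -> i < M -> b (c * M + i) = b (c * M).
  rewrite inE => /eqP bc iM; apply/eqP; rewrite eqn_leq.
  rewrite (chain_mono C (leq_addr _ _)) ?idx // andbT bc.
  by apply: (chain_mono C); rewrite ?idx ?ltn_predL ?leq_add2l; move: iM; clear; lia.
(* [b] rises within an interval that is not flat, so its starting block determines it. *)
have cflat : k <= #|flat|.
  have bk (c : 'I_(2 * k)) : b (c * M) < k.
    by apply: (chain_lt C); rewrite -[c * M]addn0 idx.
  have : #|~: flat| <= k.
    rewrite -[X in _ <= X]card_ord.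
    rewrite -(card_in_imset (f := fun c => Ordinal (bk c))); first exact: max_card.
    move=> c d; rewrite !inE => nc nd [cd]; apply/val_inj/eqP.
    have key (c1 c2 : 'I_(2 * k)) : b (c1 * M) != b (c1 * M + M.-1) -> c1 < c2 ->
        b (c1 * M) < b (c2 * M).
      move=> n12 c12; have h1 := chain_mono C (leq_addr M.-1 (c1 * M)).
      have h2 : b (c1 * M + M.-1) <= b (c2 * M).
        apply: (chain_mono C); last by rewrite -[c2 * M]addn0 idx.
        have := leq_mul2r M c1.+1 c2; rewrite c12 orbT (mulSn c1); clear -M0; lia.
      apply: leq_trans h2; rewrite ltn_neqAle n12 h1 // idx //.
      by rewrite ltn_predL.
    case: (ltngtP c d) => // [/(key _ _ nc)|/(key _ _ nd)]; rewrite cd ltnn //.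
  by have := cardsC flat; rewrite card_ord; clear; lia.
pose good c := [forall i : 'I_M, forall j : 'I_M,
  (i < j) ==> [disjoint U (c * M + i) & U (c * M + j)]].
have [/existsP[c /andP[cF /forallP gc]]|/existsPn bad] :=
    boolP [exists c, (c \in flat) && good c].
  right; exists (fun i => U (c * M + i)), (fun i => P (c * M + i)),
    (fun i => hd (c * M + i)), (fun i => b (c * M + i)).
  have dj i j v : i < j -> j < M -> v \in U (c * M + i) -> v \in U (c * M + j) -> False.
    move=> ij jM vi vj; have iM := ltn_trans ij jM.
    have /forallP/(_ (Ordinal jM))/implyP/(_ ij) d := gc (Ordinal iM).
    by rewrite (disjointFr d vi) in vj.
  split.
  - by move=> i j ij jM; apply: (chain_mono C); rewrite ?leq_add2l ?idx.
  - by move=> i iM; apply: (chain_lt C); apply: idx.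
  - by move=> i iM; apply: (chain_head C); apply: idx.
  - by move=> i v iM; apply: (chain_from C); apply: idx.
  - by move=> i v iM; rewrite addnS; apply: (chain_to C); rewrite -addnS idx.
  - by move=> i iM; rewrite addnS; apply: (chain_next_notin C); rewrite -addnS idx.
  - by move=> i iM; apply: (chain_sub C); apply: idx.
  - move=> i j v iM jM vi vj; apply/eqP; rewrite -(eqn_add2l (c * M)); apply/eqP.
    by apply: (chain_disjoint C) vi vj; apply: idx.
  - move=> v; apply/card_le1_eqP=> i j; rewrite !inE => vi vj; apply/val_inj.
    by case: (ltngtP j i) => // h; case: (dj _ _ v h (ltn_ord _)).
  - by move=> i iM; apply: (chain_close C); apply: idx.
left; pose F (c : 'I_(2 * k)) := [set v | [exists i : 'I_M, v \in U (c * M + i)]].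
apply: (@packing_of_family _ _ _ (enum flat) F); first by rewrite -cardE.
  move=> c; rewrite mem_enum => cF; have := bad c; rewrite cF /=.
  case/forallPn=> i /forallPn[j]; rewrite negb_imply => /andP[ij].
  case/pred0Pn=> v /andP[/= vi vj].
  apply: (@chain_overlap _ _ _ _ _ _ _ _ _ (c * M + i) (c * M + j) v C) => //.
  - by rewrite ltn_add2l.
  - exact: idx.
  - by rewrite !bflat.
  move=> t /andP[it tj]; apply/subsetP=> u ut; rewrite inE.
  have tM : t - c * M < M by move: (ltn_ord j) it tj; clear; lia.
  apply/existsP; exists (Ordinal tM) => /=.
  by rewrite subnKC //; apply: leq_trans it; apply: leq_addr.
move=> v; apply: leq_trans (chain_congestion C v).
rewrite -size_filter -(card_uniqP (filter_uniq _ (enum_uniq _))).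
have dv (i : 'I_(2 * k * M)) : i %/ M < 2 * k by rewrite ltn_divLR.
apply: leq_trans (leq_imset_card (fun i => Ordinal (dv i)) _).
apply: subset_leq_card; apply/subsetP=> c; rewrite mem_filter => /andP[+ _].
rewrite inE => /existsP[i vi]; apply/imsetP; exists (Ordinal (idx c i (ltn_ord i))).
  by rewrite inE.
by apply: val_inj; rewrite /= divnMDl // divn_small ?addn0.
Qed.

End Chain.

(** * Crossing chains *)

Lemma leq_sum_sub (I : finType) (A B : pred I) (F : I -> nat) :
  subpred A B -> \sum_(i | A i) F i <= \sum_(i | B i) F i.
Proof.
move=> AB; rewrite big_mkcond [X in _ <= X]big_mkcond; apply: leq_sum => i _.
by case Ai: (A i) => //; rewrite AB.
Qed.

Lemma card_pairs (I J : finType) (A : pred I) (F : I -> J -> bool) :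
  #|[set ij : I * J | A ij.1 && F ij.1 ij.2]| = \sum_(i | A i) #|[set j | F i j]|.
Proof.
rewrite -sum1dep_card; under [RHS]eq_bigr do rewrite -sum1dep_card.
by rewrite pair_big_dep.
Qed.

(** The class of a row is its prefix weight divided by [q], plus [b]. There are fewer than
    [8 * k + k] classes, and both monotone summands are constant on a class. The rows of a class
    before its last one weigh at most [q], and the last at most [w]. *)
Lemma balanced_blocks (M k w : nat) (deg : 'I_M -> nat) (b : nat -> nat) :
  let E := \sum_i deg i in
  0 < k -> (forall i, deg i <= w) ->
  (forall i j, i <= j -> j < M -> b i <= b j) -> (forall i, i < M -> b i < k) ->
  exists rho : 'I_M -> nat, [/\ forall i j : 'I_M, i <= j -> rho i <= rho j,
    forall i j : 'I_M, rho i = rho j -> b i = b j,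
    forall i, rho i < 9 * k &
    forall a, \sum_(i | rho i == a) deg i <= (E %/ (8 * k)).+1 + w].
Proof.
move=> E k0 degw mb bk; set q := (E %/ (8 * k)).+1.
pose pre (i : 'I_M) := \sum_(j : 'I_M | j < i) deg j.
have mpre (i j : 'I_M) : i <= j -> pre i <= pre j.
  by move=> ij; apply: leq_sum_sub => t /= ti; apply: leq_trans ti ij.
pose rho (i : 'I_M) := pre i %/ q + b i.
have mrho (i j : 'I_M) : i <= j -> rho i <= rho j.
  by move=> ij; apply: leq_add; rewrite ?leq_div2r ?mpre ?mb.
have erho (i j : 'I_M) : i <= j -> rho i = rho j -> pre i %/ q = pre j %/ q /\ b i = b j.
  move=> ij; have := leq_div2r q (mpre _ _ ij); have := mb _ _ ij (ltn_ord j).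
  by rewrite /rho; clear; lia.
exists rho; split=> //.
- by move=> i j rij; case: (leqP i j) => [/erho[]|/ltnW/erho[]].
- move=> i; have pE : pre i <= E by apply: leq_sum_sub.
  have : pre i %/ q < 8 * k.
    rewrite ltn_divLR //; apply: leq_ltn_trans pE _.
    by rewrite mulnC /q; apply: ltn_ceil; rewrite muln_gt0.
  by have := bk _ (ltn_ord i); rewrite /rho; clear; lia.
move=> a; have [i0 r0|h0] := pickP (fun i => rho i == a); last by rewrite big_pred0.
case: (@arg_minnP _ i0 (fun i => rho i == a) val r0) => m /eqP rm minm.
case: (@arg_maxnP _ i0 (fun i => rho i == a) val r0) => n /eqP rn maxn.
have mn : m <= n by apply: minm; rewrite rn.
have [pmn _] := erho _ _ mn (etrans rm (esym rn)).
rewrite (bigD1 n) ?rn //= addnC; apply: leq_add (degw n).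
apply: (@leq_trans (pre n - pre m)).
  rewrite leq_subRL; last exact: mpre.
  rewrite [pre n](bigID (fun j : 'I_M => j < m)) /=; apply: leq_add.
    by apply: leq_sum_sub => t /= tm; rewrite tm (leq_trans tm).
  apply: leq_sum_sub => t /= /andP[rt tn]; rewrite -leqNgt minm // andbT.
  by rewrite ltn_neqAle; apply/andP; split=> //; apply: maxn.
rewrite leq_subLR (divn_eq (pre n) q) (divn_eq (pre m) q) pmn -addnA leq_add2l.
by apply: leq_trans (ltnW (ltn_pmod _ _)) _; rewrite ?leq_addl.
Qed.

(** The constant 30: the four counts add up to at most [E / 4 + 22 k M], and [22 k M] is less than
    three quarters of [E]. *)
Lemma grid_arith (n k M D E c1 c2 c3 c4 : nat) :
  n <= k -> 0 < M -> D * (8 * k) <= E ->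
  c1 <= n * (D.+1 + M) -> c2 <= n * (D.+1 + M) ->
  c3 <= M * (9 * k) -> c4 <= M * (9 * k) -> 30 * k * M < E ->
  E <= c1 + c2 + (c3 + c4) -> False.
Proof.
move=> nk M0; have := leq_mul nk (leqnn (D.+1 + M)).
have : k <= k * M by rewrite leq_pmulr.
by nia.
Qed.

Section Grid.
Variables (M k : nat) (I : 'I_M -> 'I_M -> bool).

Definition inversion (rho gam : 'I_M -> nat) (ab : nat * nat) := exists i i' j j' : 'I_M,
  [/\ [/\ i < i', rho i = ab.1 & rho i' = ab.1],
      [/\ j < j', gam j = ab.2 & gam j' = ab.2],
      I i j' & I i' j].

(** A leftmost entry is determined by its row and its column block. *)
Lemma leftmost_card (B : nat) (gam : 'I_M -> nat) (J : 'I_M -> 'I_M -> bool) :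
  (forall j, gam j < B) ->
  #|[set ij : 'I_M * 'I_M | J ij.1 ij.2 &&
     [forall j : 'I_M, (j < ij.2) && (gam j == gam ij.2) ==> ~~ J ij.1 j]]| <= M * B.
Proof.
move=> gB.
have <- : #|{: 'I_M * 'I_B}| = M * B by rewrite card_prod !card_ord.
rewrite -(card_in_imset (f := fun ij : 'I_M * 'I_M => (ij.1, Ordinal (gB ij.2)))).
  exact: max_card.
case=> [i j] [i' j']; rewrite !inE /= => /andP[Jij /forallP h] /andP[Jij' /forallP h'].
case=> ii gg; subst i'; congr (_, _); apply: val_inj => /=.
case: (ltngtP j j') => // jj.
  by have /implyP := h' j; rewrite jj gg eqxx Jij => /(_ isT).
by have /implyP := h j'; rewrite jj gg eqxx Jij' => /(_ isT).
Qed.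

Lemma block_cover (q n : nat) (rho : 'I_M -> nat) (J : 'I_M -> 'I_M -> bool)
    (l : seq nat) :
  (forall a, \sum_(i | rho i == a) #|[set j | J i j]| <= q) -> size l <= n ->
  #|[set ij : 'I_M * 'I_M | (rho ij.1 \in l) && J ij.1 ij.2]| <= n * q.
Proof.
move=> hq sl; rewrite (card_pairs (fun i => rho i \in l)).
apply: (@leq_trans (size l * q)); last by rewrite leq_mul2r sl orbT.
elim: l {sl} => [|a l IHl]; first by rewrite big_pred0.
rewrite mulSn; apply: leq_trans (leq_add (hq a) IHl).
rewrite big_mkcond [X in _ <= X + _]big_mkcond [X in _ <= _ + X]big_mkcond.
rewrite -big_split; apply: leq_sum => i _; rewrite inE.
by case: eqP => //= _; rewrite leq_addr.
Qed.

(* Cut the rows and the columns into O(k) blocks of balanced weight. In a block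
   without inversion every entry is leftmost in its row or topmost in its
   column, so such blocks contain O(kM) entries in total, and the blocks in
   less than k rows and columns of blocks contain at most half of the entries. *)
Lemma grid_inversions (b b' : nat -> nat) : 0 < k ->
  (forall i j, i <= j -> j < M -> b i <= b j) -> (forall i, i < M -> b i < k) ->
  (forall i j, i <= j -> j < M -> b' i <= b' j) -> (forall i, i < M -> b' i < k) ->
  30 * k * M < #|[set ij : 'I_M * 'I_M | I ij.1 ij.2]| ->
  exists rho gam : 'I_M -> nat, exists l : seq (nat * nat), [/\
    (forall i j : 'I_M, i <= j -> rho i <= rho j) /\
      (forall i j : 'I_M, rho i = rho j -> b i = b j),
    (forall i j : 'I_M, i <= j -> gam i <= gam j) /\
      (forall i j : 'I_M, gam i = gam j -> b' i = b' j),
    size l = k, uniq (map fst l) /\ uniq (map snd l) &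
    forall ab, ab \in l -> inversion rho gam ab].
Proof.
move=> k0 mb bk mb' bk'; set E := #|_| => hE.
pose J j i := I i j.
have ER : E = \sum_i #|[set j | I i j]|.
  by rewrite -(card_pairs predT); apply: eq_card => ij; rewrite !inE.
have EC : E = \sum_j #|[set i | J j i]|.
  rewrite -(card_pairs predT) -(card_imset _ (f := fun ij => (ij.2, ij.1))).
    apply: eq_card => -[i j]; rewrite !inE; apply/idP/imsetP => [h|[[i' j'] + [-> ->]]].
      by exists (j, i); rewrite ?inE.
    by rewrite inE.
  by move=> [? ?] [? ?] [-> ->].
have card_le (A : {set 'I_M}) : #|A| <= M.
  by apply: leq_trans (max_card _) _; rewrite card_ord.
have [rho [mrho brho rho9 wrho]] :=
  balanced_blocks k0 (fun i => card_le [set j | I i j]) mb bk.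
have [gam [mgam bgam gam9 wgam]] :=
  balanced_blocks k0 (fun j => card_le [set i | J j i]) mb' bk'.
rewrite -ER in wrho; rewrite -EC in wgam.
exists rho, gam.
suff : forall n, n <= k -> exists l : seq (nat * nat), [/\ size l = n,
    uniq (map fst l), uniq (map snd l) & forall ab, ab \in l -> inversion rho gam ab].
  by move/(_ k (leqnn k)) => [l [sl u1 u2 hl]]; exists l.
elim=> [_|n IHn nk]; first by exists [::].
have [l [sl u1 u2 hl]] := IHn (ltnW nk).
(* Greedy step: an entry outside the used row and column blocks that is neither leftmost nor topmost
   in its block yields, with an entry to its left and one above it, a new inversion. *)
pose S1 := [set ij : 'I_M * 'I_M | (rho ij.1 \in map fst l) && I ij.1 ij.2].
pose S2 := [set ij : 'I_M * 'I_M | (gam ij.2 \in map snd l) && I ij.1 ij.2].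
pose S3 := [set ij : 'I_M * 'I_M | I ij.1 ij.2 &&
  [forall j : 'I_M, (j < ij.2) && (gam j == gam ij.2) ==> ~~ I ij.1 j]].
pose S4 := [set ij : 'I_M * 'I_M | I ij.1 ij.2 &&
  [forall i : 'I_M, (i < ij.1) && (rho i == rho ij.1) ==> ~~ I i ij.2]].
have swap (A : {set 'I_M * 'I_M}) : #|A| = #|[set ij | (ij.2, ij.1) \in A]|.
  rewrite -(card_imset A (f := fun ij => (ij.2, ij.1))).
    apply: eq_card => -[i j]; rewrite !inE; apply/imsetP/idP => [[[i' j'] + [-> ->]]//|h].
    by exists (j, i).
  by move=> [? ?] [? ?] [-> ->].
have c1 : #|S1| <= n * ((E %/ (8 * k)).+1 + M).
  by apply: block_cover wrho _; rewrite size_map sl.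
have c2 : #|S2| <= n * ((E %/ (8 * k)).+1 + M).
  rewrite swap; apply: leq_trans (block_cover (l := map snd l) wgam _).
    by apply: eq_leq; apply: eq_card => -[i j]; rewrite !inE.
  by rewrite size_map sl.
have c3 : #|S3| <= M * (9 * k) by apply: leftmost_card.
have c4 : #|S4| <= M * (9 * k).
  rewrite swap; apply: leq_trans (leftmost_card J rho9).
  by apply: eq_leq; apply: eq_card => -[i j]; rewrite !inE.
have [/subsetP sub|/subsetPn[[i j]]] :=
    boolP ([set ij : 'I_M * 'I_M | I ij.1 ij.2] \subset (S1 :|: S2) :|: (S3 :|: S4)).
  exfalso; have : E <= #|(S1 :|: S2) :|: (S3 :|: S4)|.
    by apply: subset_leq_card; apply/subsetP.
  have := leq_cardsU (S1 :|: S2) (S3 :|: S4).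
  have := leq_cardsU S1 S2; have := leq_cardsU S3 S4.
  have /card_gt0P[[i0 _] _] : 0 < E by apply: leq_ltn_trans hE.
  move=> cU34 cU12 cU cE.
  apply: (grid_arith (ltnW nk) _ (leq_divM E (8 * k)) c1 c2 c3 c4 hE).
    exact: leq_ltn_trans (leq0n i0) (ltn_ord i0).
  apply: leq_trans cE (leq_trans cU _); exact: leq_add.
rewrite !inE /= => Iij; rewrite Iij !andbT !negb_or => /andP[/andP[ni nj] /andP[]].
case/forallPn=> j0; rewrite negb_imply negbK => /andP[/andP[jj gj] Ij].
case/forallPn=> i0; rewrite negb_imply negbK => /andP[/andP[ii ri] Ii].
exists ((rho i, gam j) :: l); split=> /=; rewrite ?sl ?ni ?nj //.
move=> ab; rewrite inE => /predU1P[->|/hl//].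
by exists i0, i, j0, j; split=> //=; split=> //; apply/eqP.
Qed.
End Grid.

Section Dense.
Variables (T : finType) (e : rel T).

Lemma count_blocks (M q : nat) (rho : 'I_M -> nat) (U : nat -> {set T}) (l : seq nat) v :
  #|[set i : 'I_M | v \in U i]| <= q -> uniq l ->
  count (fun a => [exists i : 'I_M, (rho i == a) && (v \in U i)]) l <= q.
Proof.
move=> cq ul; apply: leq_trans cq; rewrite -size_filter cardE -(size_map rho).
apply: uniq_leq_size; first exact: filter_uniq.
move=> a; rewrite mem_filter => /andP[/existsP[i /andP[/eqP<- vi]] _].
by apply: map_f; rewrite mem_enum inE.
Qed.

(** In an inversion, the first chain leads from a vertex [x] of [P i] and [P' j'] to a vertex [y] of
    [P i'] and [P' j], and the second leads back. Blocks are used once in each chain, so each chain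
    contributes at most [q] to the congestion. *)
Lemma dense_packing (k q M : nat) R U P hd b R' U' P' hd' b' : 0 < k ->
  chain e R k q M U P hd b -> chain e R' k q M U' P' hd' b' ->
  30 * k * M < #|[set ij : 'I_M * 'I_M | ~~ [disjoint P ij.1 & P' ij.2]]| ->
  has_cycle_packing e k (2 * q).
Proof.
move=> k0 C C' hE.
have [rho [gam [l [[mr br] [mg bg] sl [u1 u2] hl]]]] :=
  @grid_inversions M k (fun i j => ~~ [disjoint P i & P' j]) b b' k0
    (chain_mono C) (chain_lt C) (chain_mono C') (chain_lt C') hE.
pose F1 a := [set v | [exists i : 'I_M, (rho i == a) && (v \in U i)]].
pose F2 a := [set v | [exists i : 'I_M, (gam i == a) && (v \in U' i)]].
apply: (@packing_of_family _ _ _ l (fun ab => F1 ab.1 :|: F2 ab.2)).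
- by rewrite sl.
- move=> [a c] /hl[i [i' [j [j' [/= [ii ri ri'] [jj gj gj'] ]]]]].
  case/pred0Pn=> x /andP[/= xi xj'] /pred0Pn[y /andP[/= yi' yj]].
  have span1 t : i <= t <= i' -> U t \subset F1 a :|: F2 c.
    move=> /andP[it ti]; have tM := leq_ltn_trans ti (ltn_ord i').
    apply: subset_trans (subsetUl _ _); apply/subsetP=> u ut; rewrite inE.
    apply/existsP; exists (Ordinal tM); rewrite ut andbT eqn_leq.
    by rewrite -{1}ri' mr //= -ri mr.
  have span2 t : j <= t <= j' -> U' t \subset F1 a :|: F2 c.
    move=> /andP[it ti]; have tM := leq_ltn_trans ti (ltn_ord j').
    apply: subset_trans (subsetUr _ _); apply/subsetP=> u ut; rewrite inE.
    apply/existsP; exists (Ordinal tM); rewrite ut andbT eqn_leq.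
    by rewrite -{1}gj' mg //= -gj mg.
  apply: (@cyclicb_connect _ _ _ x y).
  + apply: contraTneq ii => xy; rewrite -xy in yi'.
    by rewrite (chain_disjoint C (ltn_ord i) (ltn_ord i') xi yi') ltnn.
  + apply: (chain_connect C ii (ltn_ord i') _ span1).
    * by apply: br; rewrite ri ri'.
    * exact: (subsetP (chain_sub C (ltn_ord i))).
    * exact: (subsetP (chain_sub C (ltn_ord i'))).
  apply: (chain_connect C' jj (ltn_ord j') _ span2).
  + by apply: bg; rewrite gj gj'.
  + exact: (subsetP (chain_sub C' (ltn_ord j))).
  + exact: (subsetP (chain_sub C' (ltn_ord j'))).
move=> v.
apply: (@leq_trans (count (fun ab : nat * nat => v \in F1 ab.1) l
                    + count (fun ab : nat * nat => v \in F2 ab.2) l)).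
  rewrite -count_predUI; apply: leq_trans (leq_addr _ _).
  by apply: sub_count => ab; rewrite /= in_setU.
rewrite mul2n -addnn; apply: leq_add.
  have := count_blocks rho (chain_congestion C v) u1; rewrite count_map.
  by apply: leq_trans; apply: sub_count => ab /=; rewrite inE.
have := count_blocks gam (chain_congestion C' v) u2; rewrite count_map.
by apply: leq_trans; apply: sub_count => ab /=; rewrite inE.
Qed.
End Dense.

(** * Assembling the packing *)

Lemma leq_card_bigcup_sum (I T : finType) (A : {set I}) (F : I -> {set T}) :
  #|\bigcup_(i in A) F i| <= \sum_(i in A) #|F i|.
Proof.
elim/big_rec2: _ => [|i n S _ cS]; first by rewrite cards0.
by apply: leq_trans (leq_cardsU _ _) _; rewrite leq_add2l.
Qed.

(** At least half of the vertices have degree at most [2 * d], by averaging. A maximal independent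
    set among them dominates them. *)
Lemma sparse_independent (V : finType) (g : rel V) (d : nat) :
  symmetric g -> \sum_v #|[set u | g v u]| <= d * #|V| ->
  exists I : {set V}, {in I &, forall u v, u != v -> ~~ g u v} /\
    #|V| <= 2 * #|I| * (2 * d).+1.
Proof.
move=> gsym hd.
pose L := [set v | #|[set u | g v u]| <= 2 * d].
have cL : #|V| <= 2 * #|L|.
  have h : (2 * d).+1 * #|~: L| <= d * #|V|.
    apply: leq_trans hd; rewrite mulnC -sum_nat_const.
    apply: (@leq_trans (\sum_(v in ~: L) #|[set u | g v u]|)).
      by apply: leq_sum => v; rewrite !inE -ltnNge.
    by apply: leq_sum_sub.
  by have := cardsC L; move: h; clear; nia.
pose indep (I : {set V}) := (I \subset L) &&
  [forall u in I, forall v in I, (u != v) ==> ~~ g u v].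
have indep0 : indep set0.
  by rewrite /indep sub0set; apply/forall_inP=> u; rewrite inE.
have [I /maxsetP[/andP[IL /forall_inP hI] maxI] _] := maxset_exists indep0.
have {}hI : {in I &, forall u v, u != v -> ~~ g u v}.
  by move=> u v /hI /forall_inP h /h /implyP.
exists I; split=> //; apply: leq_trans cL _; rewrite -mulnA leq_mul2l /=.
apply: (@leq_trans #|\bigcup_(v in I) (v |: [set u | g v u])|); last first.
  apply: leq_trans (leq_card_bigcup_sum _ _) _; rewrite -sum_nat_const.
  apply: leq_sum => v vI; apply: leq_trans (leq_cardsU1 _ _) _; rewrite ltnS.
  by have := subsetP IL v vI; rewrite inE.
apply: subset_leq_card; apply/subsetP=> u uL; apply/bigcupP.
have [uI|uI] := boolP (u \in I); first by exists u; rewrite // !inE eqxx.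
have [/existsP[v /andP[vI gvu]]|/existsPn h] := boolP [exists v, (v \in I) && g v u].
  by exists v; rewrite // !inE gvu orbT.
have gI v : v \in I -> ~~ g v u by move=> vI; have := h v; rewrite vI.
have : indep (u |: I).
  rewrite /indep subUset sub1set uL IL /=; apply/forall_inP=> x xI.
  apply/forall_inP=> y yI; apply/implyP=> xy; move: xI yI; rewrite !inE.
  case/predU1P=> [xu|xI] /predU1P[yu|yI].
  - by rewrite xu yu eqxx in xy.
  - by rewrite xu gsym gI.
  - by rewrite yu gI.
  exact: hI.
by move/maxI/(_ (subsetUr _ _)) => IE; rewrite -IE !inE eqxx in uI.
Qed.

(** The constants 6 and 400: the average degree bound is [580 k^2], and [2 k (1160 k^2 + 1)] is less
    than the [2400 k^3] vertices. *)
Lemma sparse_arith (k y : nat) : y < k ->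
  6 * k * (400 * k ^ 2) <= 2 * y * (2 * (400 * k ^ 2 + 6 * k * (30 * k))).+1 ->
  False.
Proof.
case: k => // n; rewrite ltnS => yn.
have := leq_mul yn (leqnn (2 * (400 * n.+1 ^ 2 + 6 * n.+1 * (30 * n.+1))).+1).
by rewrite -mulnA !expnS expn0; nia.
Qed.

Section Assembly.
Variables (T : finType) (e : rel T).

Lemma chains_packing (k q : nat) (M := 400 * k ^ 2)
    (R : 'I_(6 * k) -> {set T}) (U P : 'I_(6 * k) -> nat -> {set T}) hd b :
  0 < k -> 0 < q -> (forall i j v, v \in R i -> v \in R j -> i = j) ->
  (forall i, chain e (R i) k q M (U i) (P i) (hd i) (b i)) ->
  has_cycle_packing e k (2 * q).
Proof.
move=> k0 q0 dR C.
pose E i j := #|[set tu : 'I_M * 'I_M | ~~ [disjoint P i tu.1 & P j tu.2]]|.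
have [/existsP[i /existsP[j]]|/existsPn sparse] :=
    boolP [exists i, exists j, 30 * k * M < E i j].
  exact: dense_packing (C i) (C j).
apply: (@has_packing_le _ _ _ 2); first by rewrite -{1}[2]muln1 leq_mul2l.
(* An independent set of [g] selects walks of different subpaths with disjoint [P]; closing each
   through its own [R], a vertex lies in at most one [P] and one [R]. *)
pose g (x y : 'I_(6 * k) * 'I_M) := (x.1 == y.1) || ~~ [disjoint P x.1 x.2 & P y.1 y.2].
have gsym : symmetric g by move=> x y; rewrite /g eq_sym disjoint_sym.
have cV : #|{: 'I_(6 * k) * 'I_M}| = 6 * k * M by rewrite card_prod !card_ord.
have [|I [hI cI]] := @sparse_independent _ g (M + 6 * k * (30 * k)) gsym.
  rewrite cV -(pair_big predT predT (fun i t => #|[set u | g (i, t) u]|)) /=.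
  have hi i : \sum_(t < M) #|[set u | g (i, t) u]| <= M * M + 6 * k * (30 * k * M).
    have ht t : #|[set u | g (i, t) u]| <=
        M + \sum_(j < 6 * k) #|[set u : 'I_M | ~~ [disjoint P i t & P j u]]|.
      have -> : [set u | g (i, t) u] = [set u | (u.1 == i) && true] :|:
           [set u : 'I_(6 * k) * 'I_M | true && ~~ [disjoint P i t & P u.1 u.2]].
        by apply/setP=> u; rewrite !inE /g /= andbT eq_sym.
      apply: leq_trans (leq_cardsU _ _) _; apply: leq_add.
        apply: leq_trans (eq_leq (card_pairs (pred1 i) (fun _ _ => true))) _.
        rewrite big_pred1_eq; apply: leq_trans (max_card _) _.
        by rewrite card_ord.
      by rewrite -(card_pairs predT); apply: eq_leq; apply: eq_card => u; rewrite !inE.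
    apply: (@leq_trans (\sum_(t < M) (M +
        \sum_(j < 6 * k) #|[set u : 'I_M | ~~ [disjoint P i t & P j u]]|))).
      by apply: leq_sum => t _; apply: ht.
    rewrite big_split /=.
    rewrite sum_nat_const card_ord leq_add2l exchange_big /=.
    rewrite -[X in _ <= X * _]card_ord -sum_nat_const; apply: leq_sum => j _.
    have := sparse i; rewrite negb_exists => /forallP/(_ j).
    rewrite -leqNgt; apply: leq_trans.
    by rewrite /E -(card_pairs predT) /=.
  apply: (@leq_trans (\sum_(i < 6 * k) (M * M + 6 * k * (30 * k * M)))).
    by apply: leq_sum => i _; apply: hi.
  rewrite sum_nat_const card_ord.
  by clear; nia.
have kI : k <= #|I|.
  rewrite leqNgt; apply/negP=> Ik; apply: (sparse_arith Ik).
  by move: cI; rewrite cV.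
apply: (@packing_of_family _ _ _ (enum I) (fun x => P x.1 x.2 :|: R x.1)).
- by rewrite -cardE.
- by move=> [i t] _; apply: chain_close (C i) _ (ltn_ord t).
move=> v.
pose QP (x : 'I_(6 * k) * 'I_M) := v \in P x.1 x.2.
pose QR (x : 'I_(6 * k) * 'I_M) := v \in R x.1.
apply: (@leq_trans (count QP (enum I) + count QR (enum I))).
  rewrite -count_predUI; apply: leq_trans (leq_addr _ _).
  by apply: sub_count => x; rewrite /= in_setU.
have one (Q : pred ('I_(6 * k) * 'I_M)) : (forall x y, Q x -> Q y -> g x y) ->
    count Q (enum I) <= 1.
  move=> hQ; rewrite -size_filter -(card_uniqP (filter_uniq _ (enum_uniq _))).
  apply/card_le1_eqP=> x y; rewrite !mem_filter => /and3P[Qx xI _] /and3P[Qy yI _].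
  by apply/eqP; apply: contraT => ne; have := hI _ _ yI xI ne; rewrite hQ.
rewrite -[2]/(1 + 1); apply: leq_add; apply: one => x y hx hy; rewrite /g.
  by apply/orP; right; apply/pred0Pn; exists v; apply/andP.
by rewrite (dR _ _ _ hx hy) eqxx.
Qed.

(** The thickness [s.+1] of the path pays for [6 * k] subpaths, each with two halves of thickness
    [r]. *)
Lemma haven_chains (k q r : nat) (M := 400 * k ^ 2) s W :
  0 < k -> 0 < q -> s.+1 = 6 * k * (r + r) ->
  (forall R (A : {set T}) nu U P, r <= #|A| -> braid e R A nu U P ->
     exists U' P' hd b, chain e R k q M U' P' hd b) ->
  haven e s W -> has_cycle_packing e k (2 * q).
Proof.
move=> k0 q0 sE mk hW.
have [p [sp up hp]] := bramble_path hW.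
have := haven_thick hW hp; rewrite sE => /thick_splits[ps [p' [pE sps tps]]].
move: sp up; rewrite pE => /cat_sorted2[sp _]; rewrite cat_uniq => /andP[up _].
have nthE i : i < size ps -> flatten ps =
    flatten (take i ps) ++ nth [::] ps i ++ flatten (drop i.+1 ps).
  move=> is_; rewrite -{1}(cat_take_drop i ps) (drop_nth [::] is_).
  by rewrite flatten_cat.
pose R (i : 'I_(6 * k)) := [set v in nth [::] ps i].
have ips (i : 'I_(6 * k)) : i < size ps by rewrite sps.
have dR i j v : v \in R i -> v \in R j -> i = j.
  have key (a c : 'I_(6 * k)) : a < c -> v \in R a -> v \in R c -> False.
    move=> ac; rewrite !inE => va vc; move: up; rewrite (nthE a) //.
    rewrite catA cat_uniq => /and3P[_ /hasPn h _].
    have /h : v \in flatten (drop a.+1 ps).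
      apply/flattenP; exists (nth [::] ps c) => //.
      have -> : nat_of_ord c = a.+1 + (c - a.+1) by rewrite subnKC.
      by rewrite -nth_drop mem_nth // size_drop ltn_sub2r // (leq_ltn_trans ac).
    by rewrite /= mem_cat va orbT.
  by move=> vi vj; apply/val_inj; case: (ltngtP i j) => // /key h; case: h.
have mkc (i : 'I_(6 * k)) : exists c : (nat -> {set T}) * (nat -> {set T}) *
    (nat -> T) * (nat -> nat), chain e (R i) k q M c.1.1.1 c.1.1.2 c.1.2 c.2.
  have := all_nthP [::] tps i (ips i) => /thick_split[X1 [X2 [XE t1 t2]]].
  have sX : sorted e (X1 ++ X2).
    by move: sp; rewrite (nthE i) // XE => /cat_sorted2[_ /cat_sorted2[]].
  have uX : uniq (X1 ++ X2).
    move: up; rewrite (nthE i) // XE cat_uniq => /and3P[_ _].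
    by rewrite cat_uniq => /andP[].
  have [A [nu [U [P [rA Br]]]]] := thick_braid sX uX t1 t2.
  have [U' [P' [hd [b Ch]]]] := mk _ _ _ _ _ rA Br.
  by exists (U', P', hd, b); rewrite /R XE.
have [c hc] := fin_all_exists mkc.
exact: (@chains_packing k q R (fun i => (c i).1.1.1) (fun i => (c i).1.1.2)
  (fun i => (c i).1.2) (fun i => (c i).2)).
Qed.

Lemma fvs_of_no_haven (k p s : nat) : 0 < p -> ~ has_cycle_packing e k p ->
  (forall W, ~~ haven e s W) ->
  exists S : {set T}, feedback_vertex_set e S /\ #|S| <= 3 * s.+1 * k.
Proof.
move=> p0 np nh.
have [[F [sF cF _ F1]]|[S cS nS]] := no_haven_erdos_posa k setT nh.
  case: np; apply: packing_of_cyclic_sets sF cF _ => v.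
  exact: leq_trans (F1 v) p0.
exists S; split; first by apply/fvsP; rewrite -setTD.
by rewrite mulnSr.
Qed.

(** Here [r = M] suffices, as braids give chains of congestion 2 directly; the bound is [3 k] times
    [s.+1 = 12 k M]. *)
Lemma fvs_quarter_integral (k : nat) : 0 < k -> ~ has_cycle_packing e k 4 ->
  exists S : {set T}, feedback_vertex_set e S /\ #|S| <= 36 * 400 * k ^ 4.
Proof.
move=> k0 np; have s0 : 0 < 12 * 400 * k ^ 3 by rewrite muln_gt0 expn_gt0 k0.
have [|S [fS cS]] := @fvs_of_no_haven k 4 (12 * 400 * k ^ 3).-1 isT np.
  move=> W; apply/negP=> hW; apply: (np).
  apply: (haven_chains (q := 2) (r := 400 * k ^ 2) _ _ _ _ hW) => //.
    by rewrite (prednK s0); clear; rewrite !expnS expn0; lia.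
  move=> R A nu U P rA Br.
  have [|/(has_packing_le (p' := 4))|//] := braid_chain k Br (M := 400 * k ^ 2).
    by rewrite rA muln_gt0 expn_gt0 k0.
  by move=> /(_ isT) /np.
exists S; split; [exact: fS|apply: leq_trans cS _; rewrite (prednK s0)].
by clear; rewrite !expnS expn0; lia.
Qed.

(** Refining to congestion 1 needs chains [2 * k] times as long, which multiplies [r], [s.+1] and
    the bound by that factor. *)
Lemma fvs_half_integral (k : nat) : 0 < k -> ~ has_cycle_packing e k 2 ->
  exists S : {set T}, feedback_vertex_set e S /\ #|S| <= 72 * 400 * k ^ 5.
Proof.
move=> k0 np; have s0 : 0 < 24 * 400 * k ^ 4 by rewrite muln_gt0 expn_gt0 k0.
have M0 : 0 < 400 * k ^ 2 by rewrite muln_gt0 expn_gt0 k0.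
have [|S [fS cS]] := @fvs_of_no_haven k 2 (24 * 400 * k ^ 4).-1 isT np.
  move=> W; apply/negP=> hW; apply: (np).
  apply: (haven_chains (q := 1) (r := 2 * k * (400 * k ^ 2)) _ _ _ _ hW) => //.
    by rewrite (prednK s0); clear; rewrite !expnS expn0; lia.
  move=> R A nu U P rA Br.
  have [|//|[U' [P' [hd [b C]]]]] := braid_chain k Br (M := 2 * k * (400 * k ^ 2)).
    by rewrite rA !muln_gt0 k0.
  by have [/np|] := chain_refine M0 C.
exists S; split; [exact: fS|apply: leq_trans cS _; rewrite (prednK s0)].
by clear; rewrite !expnS expn0; lia.
Qed.

End Assembly.

Theorem theorem1 :
  exists C2 C3 C4 : nat, [/\ 0 < C2, 0 < C3, 0 < C4 &
    forall (k : nat) (T : finType) (e : rel T), 0 < k ->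
      [/\ (~ has_cycle_packing e k 4 ->
             exists S : {set T}, feedback_vertex_set e S /\ #|S| <= C4 * k ^ 4),
          (~ has_cycle_packing e k 3 ->
             exists S : {set T}, feedback_vertex_set e S /\ #|S| <= C3 * k ^ 5)
        & (~ has_cycle_packing e k 2 ->
             exists S : {set T}, feedback_vertex_set e S /\ #|S| <= C2 * k ^ 6)]].
Proof.
(* The congestion 2 bound of order [k ^ 5] serves twice: for congestion 3 by monotonicity, and for
   congestion 2 by [k ^ 5 <= k ^ 6]. *)
exists (72 * 400), (72 * 400), (36 * 400); split; [by []|by []|by []|].
move=> k T e k0; split.
- exact: fvs_quarter_integral.
- move=> np; apply: fvs_half_integral => // pk; apply: np.
  exact: has_packing_le pk.
move=> np; have [S [fS cS]] := fvs_half_integral k0 np; exists S.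
split; [exact: fS|apply: leq_trans cS _].
by rewrite leq_mul2l leq_pexp2l ?orbT.
Qed.
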